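(* Let $d\ge 1$ and $n\ge 1$ be integers and let $f$ be a probability density on $\mathbb{S}^d$ with respect to $\sigma_d$. Assume that $f$ is square integrable, and that the kernel $L:[0,\infty)\to[0,\infty)$ is continuous, bounded and integrable, with $L(0)>0$, $0<\lambda_d(L^k)<\infty$ for $k=1,2$, and $\beta_{d,2}(L)<\infty$. Then there exists $\nu_{\rm MISE}\ge 0$ such that $\mathrm{MISE2}(\nu_{\rm MISE})\le \mathrm{MISE2}(\nu)$ for all $\nu\ge 0$.
   Context: $\mathbb{S}^d=\{\boldsymbol{x}\in\mathbb{R}^{d+1}:\boldsymbol{x}^\top\boldsymbol{x}=1\}$, $\sigma_d$ is the surface area measure on $\mathbb{S}^d$, and $\omega_d=\sigma_d(\mathbb{S}^d)=2\pi^{(d+1)/2}/\Gamma((d+1)/2)$ (so $\omega_0=2$). For a function $L$ on $[0,\infty)$, $$\lambda_d(L)=2^{d/2-1}\omega_{d-1}\int_0^\infty L(s)s^{d/2-1}\,ds,\qquad \beta_{d,j}(L)=2^{d/2}\omega_{d-1}\int_0^\infty L(s)s^{j/2+d/2-1}\,ds.$$ For $h>0$, $c_{d,L}(h)^{-1}=\int_{\mathbb{S}^d}L\big((1-\boldsymbol{x}^\top\boldsymbol{y})/h^2\big)\,\sigma_d(d\boldsymbol{x})$ (independent of $\boldsymbol{y}\in\mathbb{S}^d$) and $L_h(\boldsymbol{x},\boldsymbol{y})=c_{d,L}(h)L\big((1-\boldsymbol{x}^\top\boldsymbol{y})/h^2\big)$. Given an i.i.d. sample $\boldsymbol{X}_1,\dots,\boldsymbol{X}_n$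 from $f$, the kernel density estimator is $\hat f(\boldsymbol{x};h)=n^{-1}\sum_{i=1}^nL_h(\boldsymbol{x},\boldsymbol{X}_i)$ and $\mathrm{MISE}(h)=\mathbb{E}\int_{\mathbb{S}^d}\{\hat f(\boldsymbol{x};h)-f(\boldsymbol{x})\}^2\,\sigma_d(d\boldsymbol{x})$. In terms of the concentration $\nu=1/h$: $\mathrm{MISE2}(\nu)=\mathrm{MISE}(1/\nu)$ for $\nu>0$ and $\mathrm{MISE2}(0)=\int_{\mathbb{S}^d}\{\omega_d^{-1}-f(\boldsymbol{x})\}^2\,\sigma_d(d\boldsymbol{x})$. *)

(* Defs.v *)
From HB Require Import structures.
From mathcomp Require Import all_boot all_order all_algebra.
From mathcomp Require Import all_classical all_reals all_analysis.
From mathcomp Require Import measurable_realfun.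

Set Implicit Arguments.
Unset Strict Implicit.
Unset Printing Implicit Defensive.
Import Order.TTheory GRing.Theory Num.Theory.
Import numFieldNormedType.Exports.
Local Open Scope classical_set_scope.
Local Open Scope ring_scope.

(* R^n is [n.-tuple R], whose library sigma-algebra is generated by the
   coordinates and is therefore the Borel one. *)

Section lebesgue_cons.
Context (R : realType) (n : nat).

Definition tcons (p : R * n.-tuple R) : n.+1.-tuple R := [tuple of p.1 :: p.2].

Lemma measurable_tcons : measurable_fun setT tcons.
Proof. exact: measurable_cons. Qed.

Lemma behead_tcons p : [tuple of behead (tcons p)] = p.2.
Proof. exact: val_inj. Qed.

Variable mu : {sigma_finite_measure set (n.-tuple R) -> \bar R}.

Let prodm : {measure set (measurableTypeR R * n.-tuple R)%type -> \bar R} :=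
  (@lebesgue_measure R \x mu)%E.

Definition lebesgue_cons : set (n.+1.-tuple R) -> \bar R :=
  pushforward (@lebesgue_measure R \x mu)%E tcons.

Let m' := @measure_function_pushforward__canonical__measure_function_Measure
  _ _ _ _ _ prodm tcons measurable_tcons.

Let lc0 : lebesgue_cons set0 = 0%E.
Proof. exact: (measure0 m'). Qed.
Let lc_ge0 A : (0 <= lebesgue_cons A)%E.
Proof. exact: (measure_ge0 m'). Qed.
Let lc_sadd : semi_sigma_additive lebesgue_cons.
Proof. exact: (@measure_semi_sigma_additive _ _ _ m'). Qed.

HB.instance Definition _ :=
  isMeasure.Build _ _ _ lebesgue_cons lc0 lc_ge0 lc_sadd.

Lemma lebesgue_consE (A : set R) (B : set (n.-tuple R)) :
  measurable A -> measurable B ->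
  lebesgue_cons [set x | A (thead x) /\ B [tuple of behead x]] =
    (lebesgue_measure A * mu B)%E.
Proof.
move=> mA mB; rewrite -(product_measure1E (@lebesgue_measure R) mu mA mB).
rewrite /lebesgue_cons /pushforward; congr (_ _).
by apply/seteqP; split=> -[a b] /=; rewrite behead_tcons theadE.
Qed.

Lemma measurable_thead_behead (A : set R) (B : set (n.-tuple R)) :
  measurable A -> measurable B ->
  measurable [set x : n.+1.-tuple R | A (thead x) /\ B [tuple of behead x]].
Proof.
move=> mA mB; apply: measurableI.
  by rewrite -[X in measurable X]setTI; exact: (measurable_tnth ord0).
by rewrite -[X in measurable X]setTI; exact: measurable_behead.
Qed.

Let lc_sigma_finite : sigma_finite setT lebesgue_cons.
Proof.
have /sigma_finiteP[F [TF ndF Foo]] := sigma_finiteT (@lebesgue_measure R).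
have /sigma_finiteP[G [TG ndG Goo]] := sigma_finiteT mu.
exists (fun k => [set x | F k (thead x) /\ G k [tuple of behead x]]).
  apply/seteqP; split=> // x _.
  have : setT (thead x) by [].
  have : setT [tuple of behead x] by [].
  rewrite TF TG => -[i _ Gi] [j _ Fj]; exists (maxn i j) => //=; split.
    by move: Fj; apply/subsetPset/ndF/leq_maxr.
  by move: Gi; apply/subsetPset/ndG/leq_maxl.
move=> k; have [mF Fk] := Foo k; have [mG Gk] := Goo k.
split; first exact: measurable_thead_behead.
by rewrite lebesgue_consE// lte_mul_pinfty// ge0_fin_numE.
Qed.

HB.instance Definition _ :=
  Measure_isSigmaFinite.Build _ _ _ lebesgue_cons lc_sigma_finite.

End lebesgue_cons.

Fixpoint lebesgue_tuple (R : realType) (n : nat) :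
    {sigma_finite_measure set (n.-tuple R) -> \bar R} :=
  match n with
  | 0 => \d_([tuple] : 0.-tuple R)
  | m.+1 => lebesgue_cons (lebesgue_tuple R m)
  end.

Definition box (R : realType) (n : nat) : set (n.-tuple R) :=
  [set x | forall i, -1 <= tnth x i <= 1].
Arguments box : clear implicits.

Lemma boxS (R : realType) (n : nat) : box R n.+1 =
  [set x | [set` `[(-1)%R, 1%R]] (thead x) /\ box R n [tuple of behead x]].
Proof.
apply/seteqP; split=> x /=.
  move=> bx; split=> [|i].
    by rewrite in_itv /= /thead; exact: bx.
  by have := bx (lift ord0 i); rewrite {1 2}(tuple_eta x) !tnthS.
rewrite in_itv /= => -[x0 bx] i; case: (unliftP ord0 i) => [j|] ->//.
by rewrite (tuple_eta x) tnthS; exact: bx.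
Qed.

Lemma measurable_box (R : realType) (n : nat) : measurable (box R n).
Proof.
elim: n => [|n IH]; last by rewrite boxS; exact: measurable_thead_behead.
by rewrite (_ : box R 0 = setT)//; apply/seteqP; split=> // x _ [].
Qed.

Lemma lebesgue_tuple_box_lty (R : realType) (n : nat) :
  (lebesgue_tuple R n (box R n) < +oo)%E.
Proof.
elim: n => [|n IH].
  by rewrite /= diracE; case: (_ \in _); rewrite ltry.
rewrite boxS [ltLHS](lebesgue_consE (lebesgue_tuple R n)) //; last exact: measurable_box.
rewrite lte_mul_pinfty// lebesgue_measure_itv /= lte_fin.
by case: ifP.
Qed.

Section sphere.
Context (R : realType).
Implicit Types n d : nat.

Definition dotp n (x y : n.-tuple R) : R := \sum_(i < n) tnth x i * tnth y i.
Definition norm2 n (x : n.-tuple R) : R := Num.sqrt (dotp x x).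
Definition scalet n (r : R) (x : n.-tuple R) : n.-tuple R :=
  [tuple r * tnth x i | i < n].
Definition dir n (x : n.-tuple R) : n.-tuple R := scalet (norm2 x)^-1 x.

Definition sphere d : set (d.+1.-tuple R) := [set x | dotp x x = 1].

Definition cone d (A : set (d.+1.-tuple R)) : set (d.+1.-tuple R) :=
  [set x | exists r u, [/\ 0 < r <= 1, sphere u, A u & x = scalet r u]].

(* Surface area as the cone measure of polar coordinates: sigma_d(A) is d + 1
   times the Lebesgue volume of the cone {r u | 0 < r <= 1, u in A}. As a measure
   on R^{d+1} it is carried by the sphere. For d = 0 it is the counting measure
   on {-1, 1}. *)
Definition surface_measure d (A : set (d.+1.-tuple R)) : \bar R :=
  (d.+1%:R%:E * lebesgue_tuple R d.+1 (cone A))%E.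
Arguments surface_measure : clear implicits.

Lemma dotpZ n r s (x y : n.-tuple R) :
  dotp (scalet r x) (scalet s y) = r * s * dotp x y.
Proof.
by rewrite /dotp big_distrr /=; apply: eq_bigr => i _; rewrite !tnth_mktuple mulrACA.
Qed.

Lemma dotp_ge0 n (x : n.-tuple R) : 0 <= dotp x x.
Proof. by apply: sumr_ge0 => i _; rewrite -expr2 sqr_ge0. Qed.

Lemma scalet1 n (x : n.-tuple R) : scalet 1 x = x.
Proof. by apply: eq_from_tnth => i; rewrite tnth_mktuple mul1r. Qed.

Lemma scaletA n r s (x : n.-tuple R) : scalet r (scalet s x) = scalet (r * s) x.
Proof. by apply: eq_from_tnth => i; rewrite !tnth_mktuple mulrA. Qed.

Lemma coneE d (A : set (d.+1.-tuple R)) :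
  cone A = [set x | 0 < norm2 x <= 1] `&` (@dir d.+1 @^-1` A).
Proof.
apply/seteqP; split=> x /=.
  move=> [r [u [r01 su Au ->]]]; have r0 : 0 < r by case/andP: r01.
  have nr : norm2 (scalet r u) = r.
    by rewrite /norm2 dotpZ su mulr1 -expr2 sqrtr_sqr gtr0_norm.
  by rewrite /dir nr scaletA mulVf ?gt_eqF// scalet1.
move=> [n01 Ax]; have n0 : 0 < norm2 x by case/andP: n01.
exists (norm2 x), (dir x); split=> //; last first.
  by rewrite /dir scaletA mulfV ?gt_eqF// scalet1.
have e : dotp x x = norm2 x * norm2 x by rewrite -expr2 sqr_sqrtr ?dotp_ge0.
by rewrite /sphere /= /dir dotpZ e mulrACA mulVf ?gt_eqF// mulr1.
Qed.

Lemma measurable_dotp dT (T : measurableType dT) n (f g : T -> n.-tuple R) :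
  measurable_fun setT f -> measurable_fun setT g ->
  measurable_fun setT (fun t => dotp (f t) (g t)).
Proof.
move=> mf mg; apply: measurable_sum => i; apply: measurable_funM.
  by move/measurable_fun_tnthP : mf; exact.
by move/measurable_fun_tnthP : mg; exact.
Qed.

Lemma measurable_norm2 n : measurable_fun setT (@norm2 n).
Proof.
rewrite (_ : @norm2 n = fun x => dotp x x `^ 2^-1); last first.
  by apply/funext => x; rewrite powR12_sqrt// dotp_ge0.
apply: (@measurableT_comp _ _ _ _ _ _ (fun z => z `^ 2^-1)).
  exact: measurable_powR.
exact: measurable_dotp.
Qed.

Lemma measurable_dir n : measurable_fun setT (@dir n).
Proof.
apply/measurable_fun_tnthP => i.
rewrite (_ : _ \o _ = fun x => norm2 x `^ (-1) * tnth x i); last first.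
  by apply/funext => x /=; rewrite tnth_mktuple powR_inv1// sqrtr_ge0.
apply: measurable_funM; last exact: measurable_tnth.
apply: (@measurableT_comp _ _ _ _ _ _ (fun z => z `^ (-1))).
  exact: measurable_powR.
exact: measurable_norm2.
Qed.

Lemma measurable_punctured_ball n :
  measurable [set x : n.-tuple R | 0 < norm2 x <= 1].
Proof.
rewrite (_ : mkset _ = @norm2 n @^-1` `]0, 1]%classic).
  rewrite -[X in measurable X]setTI; exact: measurable_norm2.
by apply/seteqP; split=> x /=; rewrite in_itv.
Qed.

Lemma punctured_ball_box n : [set x : n.-tuple R | 0 < norm2 x <= 1] `<=` box R n.
Proof.
move=> x /andP[_ x1] i; rewrite -ler_norml; apply: le_trans x1.
rewrite /norm2 -sqrtr_sqr ler_wsqrtr// /dotp (bigD1 i)//= -expr2 lerDl.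
by apply: sumr_ge0 => j _; rewrite -expr2 sqr_ge0.
Qed.

Section surface_measure_instance.
Variable d : nat.

Let restr := mrestr (lebesgue_tuple R d.+1) (@measurable_punctured_ball d.+1).

Let push := @measure_function_pushforward__canonical__measure_function_Measure
  _ _ _ _ _ restr (@dir d.+1) (@measurable_dir d.+1).

Let m' : {measure set (d.+1.-tuple R) -> \bar R} := mscale d.+1%:R%:nng push.

Let smE : surface_measure d = m'.
Proof.
by apply/funext => A; rewrite /surface_measure coneE setIC.
Qed.

Let sm0 : surface_measure d set0 = 0%E.
Proof. by rewrite smE measure0. Qed.
Let sm_ge0 A : (0 <= surface_measure d A)%E.
Proof. by rewrite smE measure_ge0. Qed.
Let sm_sadd : semi_sigma_additive (surface_measure d).
Proof. by rewrite smE; exact: measure_semi_sigma_additive. Qed.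

HB.instance Definition _ :=
  isMeasure.Build _ _ _ (surface_measure d) sm0 sm_ge0 sm_sadd.

Let sm_fin : fin_num_fun (surface_measure d).
Proof.
move=> A mA; rewrite ge0_fin_numE// /surface_measure lte_mul_pinfty// coneE.
apply: le_lt_trans (lebesgue_tuple_box_lty R d.+1).
apply: le_measure; rewrite ?inE.
- apply: measurableI; first exact: measurable_punctured_ball.
  by rewrite -[X in measurable X]setTI; exact: measurable_dir.
- exact: measurable_box.
- by apply: subset_trans (@punctured_ball_box d.+1); exact: subIsetl.
Qed.

HB.instance Definition _ :=
  Measure_isFinite.Build _ _ _ (surface_measure d) sm_fin.

End surface_measure_instance.

End sphere.
Arguments surface_measure : clear implicits.
Arguments sphere : clear implicits.

Section circular_kernel.
Context (R : realType).
Implicit Types (d : nat) (L : R -> R) (h : R).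

Definition omega d : R := fine (surface_measure R d (sphere R d)).

(* At s = 0 the library sets 0 `^ p = 0 for p <> 0, which only affects the
   integrands below on a null set. *)
Definition lambda d L : \bar R :=
  ((2 `^ (d%:R / 2 - 1) * omega d.-1)%:E *
   \int[lebesgue_measure]_(s in `[0%R, +oo[) (L s * s `^ (d%:R / 2 - 1))%:E)%E.

Definition beta d (j : nat) L : \bar R :=
  ((2 `^ (d%:R / 2) * omega d.-1)%:E *
   \int[lebesgue_measure]_(s in `[0%R, +oo[)
     (L s * s `^ (j%:R / 2 + d%:R / 2 - 1))%:E)%E.

(* The integral does not depend on y in the sphere, by rotation invariance;
   it is taken at the point y at which the kernel is centred. *)
Definition norm_const d L h (y : d.+1.-tuple R) : R :=
  (fine (\int[surface_measure R d]_(x in sphere R d)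
           (L ((1 - dotp x y) / h ^+ 2))%:E))^-1.

Definition scaled_kernel d L h (x y : d.+1.-tuple R) : R :=
  norm_const L h y * L ((1 - dotp x y) / h ^+ 2).

Definition kde d n L (X : 'I_n -> d.+1.-tuple R) h (x : d.+1.-tuple R) : R :=
  n%:R^-1 * \sum_(i < n) scaled_kernel L h x (X i).

Definition is_density d (f : d.+1.-tuple R -> R) :=
  [/\ measurable_fun (sphere R d) f,
      (forall x, sphere R d x -> 0 <= f x) &
      (\int[surface_measure R d]_(x in sphere R d) (f x)%:E = 1)%E].

Definition square_integrable d (f : d.+1.-tuple R -> R) :=
  (\int[surface_measure R d]_(x in sphere R d) (f x ^+ 2)%:E < +oo)%E.

Context (dO : measure_display) (Omega : measurableType dO)
  (P : probability Omega R).

Definition mutually_independent (dT : measure_display) (T : measurableType dT)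
    (n : nat) (X : 'I_n -> {RV P >-> T}) :=
  forall (J : {set 'I_n}) (A : 'I_n -> set T),
    (forall i, measurable (A i)) ->
    (P (\bigcap_(i in [set` J]) (X i @^-1` A i)) =
     \big[*%E/1]_(i in J) P (X i @^-1` A i))%E.

(* The sample takes its values in the sphere and each X i has law f sigma_d. *)
Definition iid_sample d n (f : d.+1.-tuple R -> R)
    (X : 'I_n -> {RV P >-> d.+1.-tuple R}) :=
  [/\ (forall i w, sphere R d (X i w)),
      (forall i (A : set (d.+1.-tuple R)), measurable A ->
        (P (X i @^-1` A) =
         \int[surface_measure R d]_(x in sphere R d `&` A) (f x)%:E)%E) &
      mutually_independent X].

Definition MISE d n L (f : d.+1.-tuple R -> R)
    (X : 'I_n -> {RV P >-> d.+1.-tuple R}) h : \bar R :=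
  (\int[P]_w \int[surface_measure R d]_(x in sphere R d)
     ((kde L (fun i => X i w) h x - f x) ^+ 2)%:E)%E.

Definition MISE2 d n L (f : d.+1.-tuple R -> R)
    (X : 'I_n -> {RV P >-> d.+1.-tuple R}) (nu : R) : \bar R :=
  if nu == 0 then
    (\int[surface_measure R d]_(x in sphere R d)
       (((omega d)^-1 - f x) ^+ 2)%:E)%E
  else MISE L f X nu^-1.

End circular_kernel.

(* Main.v *)
Require Import Defs.
From HB Require Import structures.
From mathcomp Require Import all_boot all_order all_algebra.
From mathcomp Require Import all_classical all_reals all_analysis.
From mathcomp Require Import measurable_realfun ring lra zify.
Import Order.TTheory GRing.Theory Num.Theory.
Import numFieldNormedType.Exports.
Local Open Scope classical_set_scope.
Local Open Scope ring_scope.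

(* MISE2 is sequentially lower semicontinuous on [0, +oo[ and tends to +oo, so a
   minimizing sequence has a convergent subsequence whose limit is a minimizer.

   Lower semicontinuity is Fatou's lemma on the product of the sample space and
   the sphere: the normalizing constant, hence the estimator at a fixed point,
   is continuous in nu, including at nu = 0, where it is the uniform density.

   For the divergence, sample points lie on the sphere and L >= 0, so the
   integral over the sphere of the squared estimator is at least B / (n A)^2,
   where A and B are the integrals of L and L^2 composed with (1 - x.y) nu^2; by
   rotation invariance they do not depend on y. Split A into the part where
   |x.y| > 1 - del and the rest. By Cauchy-Schwarz the square of the first is at
   most B times the area of two small caps. The law of x.y has a bounded density
   away from -1 and 1, so the second is O(nu^-2) times the tail of the integral
   of L beyond a multiple of nu^2, while B >= c nu^-d. Hence A^2 = o(B). *)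

Set Implicit Arguments.
Unset Strict Implicit.
Unset Printing Implicit Defensive.

(** * Lebesgue measure on tuples *)

(** At infinity [L] is controlled through integrals only, not pointwise, so away from the pole A can
    be bounded only through the law of x.y. Its density is proportional to (1 - t^2)^(d/2 - 1),
    which for d = 1 blows up at both poles: hence two caps and the absolute value |x.y|. The tail T
    beyond a multiple of nu^2 satisfies T^2 nu^(2(d - 2)) = O(1), with truncated subtraction: by
    integrability of [L] if d <= 2, by finiteness of [lambda d L] if d > 2. The square of the second
    part is then O(nu^-(d + 1)), one power of nu below B.

    Integrals over the sphere are pulled back to Lebesgue measure on R^(d+1) through the cone that
    defines the surface measure. Rotation invariance comes from factoring a plane rotation into
    shears, each a translation on coordinate slices; the bounded density comes from slicing the ball
    by lines parallel to the first axis and substituting on each line.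

    To obtain a kernel continuous on all of R, [L] is replaced by s |-> L (max s 0), which changes
    nothing on the sphere since 1 - x.y >= 0 there. *)

Section lebesgue_tuple_integral.
Context {R : realType}.
Implicit Types n : nat.
Local Notation mu := (@lebesgue_measure R).
Local Notation vol := (lebesgue_tuple R).

Let prodm n : {measure set (measurableTypeR R * n.-tuple R)%type -> \bar R} :=
  (mu \x vol n)%E.

Lemma integral_lebesgue_tupleS n (G : n.+1.-tuple R -> \bar R) :
  measurable_fun setT G -> (forall x, 0 <= G x)%E ->
  (\int[vol n.+1]_x G x = \int[vol n]_y \int[mu]_t G (tcons (t, y)))%E.
Proof.
move=> mG G0.
rewrite [LHS](@ge0_integral_pushforward _ _ (measurableTypeR R * n.-tuple R)%type _ R (@tcons R n)
  (@measurable_tcons R n) (prodm n) setT G measurableT mG); last by move=> y _; exact: G0.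
rewrite preimage_setT (@fubini_tonelli2 _ _ _ _ R mu (vol n) (G \o @tcons R n))//=.
- by apply: (measurableT_comp mG); exact: measurable_tcons.
Qed.

Lemma integral_lebesgue_tupleSr n (G : n.+1.-tuple R -> \bar R) :
  measurable_fun setT G -> (forall x, 0 <= G x)%E ->
  (\int[vol n.+1]_x G x = \int[mu]_t \int[vol n]_y G (tcons (t, y)))%E.
Proof.
move=> mG G0.
rewrite [LHS](@ge0_integral_pushforward _ _ (measurableTypeR R * n.-tuple R)%type _ R (@tcons R n)
  (@measurable_tcons R n) (prodm n) setT G measurableT mG); last by move=> y _; exact: G0.
rewrite preimage_setT (@fubini_tonelli1 _ _ _ _ R mu (vol n) (G \o @tcons R n))//=.
- by apply: (measurableT_comp mG); exact: measurable_tcons.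
Qed.

Lemma lebesgue_measureD (a : R) (A : set R) : measurable A ->
  pushforward mu ((fun x => x + a) : _ -> measurableTypeR R) A = mu A.
Proof.
move=> mA.
have ma : measurable_fun setT (fun x : measurableTypeR R => (x + a)%R : measurableTypeR R).
  by apply: measurable_funD => //; exact: measurable_cst.
pose m := @measure_function_pushforward__canonical__measure_function_Measure
  _ _ _ _ _ mu _ ma.
apply/esym/(@lebesgue_measure_unique _ m) => //= _ [[b c]] _ <-.
rewrite /pushforward (_ : _ @^-1` _ = `]b - a, c - a]%classic); last first.
  by apply/seteqP; split => x; rewrite /= !in_itv/= ltrBlDr lerBrDr.
by rewrite !lebesgue_measure_itv/= !lte_fin ltrD2r; case: ifP => // _; rewrite -!EFinD opprB addrA subrK.
Qed.

Lemma ge0_integral_translation (a : R) (f : R -> \bar R) :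
  measurable_fun setT f -> (forall x, 0 <= f x)%E ->
  (\int[mu]_x f (x + a)%R = \int[mu]_x f x)%E.
Proof.
move=> mf f0.
have ma : measurable_fun setT (fun x : measurableTypeR R => (x + a)%R : measurableTypeR R).
  by apply: measurable_funD => //; exact: measurable_cst.
pose m := @measure_function_pushforward__canonical__measure_function_Measure
  _ _ _ _ _ mu _ ma.
transitivity (\int[m]_x f x)%E.
  by rewrite (ge0_integral_pushforward ma).
by apply: eq_measure_integral => A mA _; exact: lebesgue_measureD.
Qed.

Lemma ge0_integral_opp (f : R -> \bar R) :
  measurable_fun setT f -> (forall x, 0 <= f x)%E ->
  (\int[mu]_x f (- x)%R = \int[mu]_x f x)%E.
Proof.
move=> mf f0.
have ma : measurable_fun setT (fun x : measurableTypeR R => (- x)%R : measurableTypeR R).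
  exact: oppr_measurable.
pose m := @measure_function_pushforward__canonical__measure_function_Measure
  _ _ _ _ _ mu _ ma.
transitivity (\int[m]_x f x)%E.
  by rewrite (ge0_integral_pushforward ma).
by apply: eq_measure_integral => A mA _; exact: lebesgue_measureN.
Qed.

Definition tbehead n (x : n.+1.-tuple R) : n.-tuple R := [tuple of behead x].

Definition addt n (x y : n.-tuple R) : n.-tuple R :=
  [tuple tnth x i + tnth y i | i < n].

Lemma tcons_eta n (x : n.+1.-tuple R) : tcons (thead x, tbehead x) = x.
Proof. by rewrite [RHS]tuple_eta. Qed.

Lemma thead_tcons n t (y : n.-tuple R) : thead (tcons (t, y)) = t.
Proof. by rewrite /tcons /= theadE. Qed.

Lemma tbehead_tcons n t (y : n.-tuple R) : tbehead (tcons (t, y)) = y.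
Proof. exact: behead_tcons. Qed.

Lemma addt_tcons n s t (x y : n.-tuple R) :
  addt (tcons (s, x)) (tcons (t, y)) = tcons (s + t, addt x y).
Proof.
apply: eq_from_tnth => i; rewrite tnth_mktuple /tcons /=.
by case: (unliftP ord0 i) => [j|] ->; rewrite ?tnth0 ?tnthS ?tnth_mktuple.
Qed.

Lemma dotp_tcons n s t (x y : n.-tuple R) :
  dotp (tcons (s, x)) (tcons (t, y)) = s * t + dotp x y.
Proof.
rewrite /dotp big_ord_recl /tcons /= !tnth0; congr (_ + _).
by apply: eq_bigr => i _; rewrite !tnthS.
Qed.

Lemma measurable_thead n : measurable_fun setT (@thead n R).
Proof. exact: measurable_tnth. Qed.

Lemma measurable_tbehead n : measurable_fun setT (@tbehead n).
Proof. exact: measurable_behead. Qed.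

Lemma measurable_fun_tcons dT (T : measurableType dT) n (f : T -> R)
    (g : T -> n.-tuple R) :
  measurable_fun setT f -> measurable_fun setT g ->
  measurable_fun setT (fun t => tcons (f t, g t)).
Proof. by move=> mf mg; exact: (measurable_cons mf mg). Qed.

Lemma measurable_addt dT (T : measurableType dT) n (f g : T -> n.-tuple R) :
  measurable_fun setT f -> measurable_fun setT g ->
  measurable_fun setT (fun t => addt (f t) (g t)).
Proof.
move=> /measurable_fun_tnthP mf /measurable_fun_tnthP mg.
apply/measurable_fun_tnthP => i.
rewrite (_ : _ \o _ = (fun t => tnth (f t) i + tnth (g t) i)); last first.
  by apply/funext => t /=; rewrite tnth_mktuple.
exact: measurable_funD (mf i) (mg i).
Qed.

Lemma measurable_scalet dT (T : measurableType dT) n (f : T -> R) (g : T -> n.-tuple R) :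
  measurable_fun setT f -> measurable_fun setT g ->
  measurable_fun setT (fun t => scalet (f t) (g t)).
Proof.
move=> mf /measurable_fun_tnthP mg.
apply/measurable_fun_tnthP => i.
rewrite (_ : _ \o _ = (fun t => f t * tnth (g t) i)); last first.
  by apply/funext => t /=; rewrite tnth_mktuple.
exact: measurable_funM mf (mg i).
Qed.

Lemma ge0_integral_addt n (v : n.-tuple R) (G : n.-tuple R -> \bar R) :
  measurable_fun setT G -> (forall x, 0 <= G x)%E ->
  (\int[vol n]_x G (addt x v) = \int[vol n]_x G x)%E.
Proof.
elim: n v G => [|n IH] v G mG G0.
  by apply: eq_integral => x _; congr G; rewrite (tuple0 (addt x v)) (tuple0 x).
have mG' : measurable_fun setT (fun x => G (addt x v)).
  apply: (measurableT_comp mG); apply: measurable_addt => //; exact: measurable_cst.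
rewrite (integral_lebesgue_tupleSr mG' (fun=> G0 _)) (integral_lebesgue_tupleSr mG G0).
have mGt t : measurable_fun setT (fun y => G (tcons (t, y))).
  by apply: (measurableT_comp mG); exact: measurable_fun_tcons.
pose H t := (\int[vol n]_y G (tcons (t, y)))%E.
transitivity (\int[mu]_t H (t + thead v)%R)%E.
  apply: eq_integral => t _; rewrite /H -[RHS](IH (tbehead v))//.
  by apply: eq_integral => y _; rewrite -{1}(tcons_eta v) addt_tcons.
apply: ge0_integral_translation.
  apply: (@measurable_fun_fubini_tonelli_F _ _ _ _ _ (vol n) (fun p => G (tcons p))) => //.
  by apply: (measurableT_comp mG); exact: measurable_tcons.
by move=> t; apply: integral_ge0.
Qed.

Lemma dotpC n (x y : n.-tuple R) : dotp x y = dotp y x.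
Proof. by apply: eq_bigr => i _; rewrite mulrC. Qed.

Lemma dotpDr n (x y z : n.-tuple R) : dotp x (addt y z) = dotp x y + dotp x z.
Proof.
rewrite /dotp -big_split /=; apply: eq_bigr => i _.
by rewrite tnth_mktuple mulrDr.
Qed.

Lemma dotpZr n r (x y : n.-tuple R) : dotp x (scalet r y) = r * dotp x y.
Proof. by rewrite -{1}(scalet1 x) dotpZ mul1r. Qed.

Lemma dotpZl n r (x y : n.-tuple R) : dotp (scalet r x) y = r * dotp x y.
Proof. by rewrite dotpC dotpZr dotpC. Qed.

Definition shear1 n (a : n.-tuple R) (x : n.+1.-tuple R) : n.+1.-tuple R :=
  tcons (thead x + dotp a (tbehead x), tbehead x).

Definition shear2 n (b : n.-tuple R) (x : n.+1.-tuple R) : n.+1.-tuple R :=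
  tcons (thead x, addt (tbehead x) (scalet (thead x) b)).

Lemma measurable_shear1 n (a : n.-tuple R) : measurable_fun setT (shear1 a).
Proof.
apply: measurable_fun_tcons; last exact: measurable_tbehead.
apply: measurable_funD; first exact: measurable_thead.
by apply: measurable_dotp; [exact: measurable_cst|exact: measurable_tbehead].
Qed.

Lemma measurable_shear2 n (a : n.-tuple R) : measurable_fun setT (shear2 a).
Proof.
apply: measurable_fun_tcons; first exact: measurable_thead.
apply: measurable_addt; first exact: measurable_tbehead.
by apply: measurable_scalet; [exact: measurable_thead|exact: measurable_cst].
Qed.

(** By Fubini with the head innermost: for a fixed tail [y] the shear is a translation of the line
    by the constant [dotp a y]. For [shear2] the roles of head and tail are exchanged. *)
Lemma ge0_integral_shear1 n (a : n.-tuple R) (G : n.+1.-tuple R -> \bar R) :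
  measurable_fun setT G -> (forall x, 0 <= G x)%E ->
  (\int[vol n.+1]_x G (shear1 a x) = \int[vol n.+1]_x G x)%E.
Proof.
move=> mG G0; have mG' := measurableT_comp mG (measurable_shear1 a).
rewrite (integral_lebesgue_tupleS mG' (fun=> G0 _)) (integral_lebesgue_tupleS mG G0).
apply: eq_integral => y _.
rewrite -(ge0_integral_translation (dotp a y) (f := fun t => G (tcons (t, y))))//.
  by apply: eq_integral => t _; rewrite /comp /shear1 thead_tcons tbehead_tcons.
by apply: (measurableT_comp mG); exact: measurable_fun_tcons.
Qed.

Lemma ge0_integral_shear2 n (a : n.-tuple R) (G : n.+1.-tuple R -> \bar R) :
  measurable_fun setT G -> (forall x, 0 <= G x)%E ->
  (\int[vol n.+1]_x G (shear2 a x) = \int[vol n.+1]_x G x)%E.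
Proof.
move=> mG G0; have mG' := measurableT_comp mG (measurable_shear2 a).
rewrite (integral_lebesgue_tupleSr mG' (fun=> G0 _)) (integral_lebesgue_tupleSr mG G0).
apply: eq_integral => t _.
rewrite -(ge0_integral_addt (scalet t a) (G := fun y => G (tcons (t, y))))//.
  by apply: eq_integral => y _; rewrite /comp /shear2 thead_tcons tbehead_tcons.
by apply: (measurableT_comp mG); exact: measurable_fun_tcons.
Qed.

Definition flip n (x : n.+1.-tuple R) : n.+1.-tuple R :=
  tcons (- thead x, tbehead x).

Lemma measurable_flip n : measurable_fun setT (@flip n).
Proof.
apply: measurable_fun_tcons; last exact: measurable_tbehead.
by apply: measurableT_comp; last exact: measurable_thead.
Qed.

Lemma ge0_integral_flip n (G : n.+1.-tuple R -> \bar R) :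
  measurable_fun setT G -> (forall x, 0 <= G x)%E ->
  (\int[vol n.+1]_x G (flip x) = \int[vol n.+1]_x G x)%E.
Proof.
move=> mG G0; have mG' := measurableT_comp mG (@measurable_flip n).
rewrite (integral_lebesgue_tupleS mG' (fun=> G0 _)) (integral_lebesgue_tupleS mG G0).
apply: eq_integral => y _.
rewrite -(ge0_integral_opp (f := fun t => G (tcons (t, y))))//.
  by apply: eq_integral => t _; rewrite /comp /flip thead_tcons tbehead_tcons.
by apply: (measurableT_comp mG); exact: measurable_fun_tcons.
Qed.

End lebesgue_tuple_integral.

(** * Rotations *)

Section rotation.
Context {R : realType}.
Implicit Types n : nat.
Local Notation mu := (@lebesgue_measure R).
Local Notation vol := (lebesgue_tuple R).

(* For a unit vector y with 1 + thead y != 0, the rotation of the plane spanned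
   by y and the first basis vector e that maps y to e, written as a product of
   three shears. *)
Definition rotation n (y x : n.+1.-tuple R) : n.+1.-tuple R :=
  let a := scalet (1 + thead y)^-1 (tbehead y) in
  shear1 a (shear2 (scalet (- 1) (tbehead y)) (shear1 a x)).

Lemma ge0_integral_rotation n (y : n.+1.-tuple R) (G : n.+1.-tuple R -> \bar R) :
  measurable_fun setT G -> (forall x, 0 <= G x)%E ->
  (\int[vol n.+1]_x G (rotation y x) = \int[vol n.+1]_x G x)%E.
Proof.
move=> mG G0; rewrite /rotation.
set a := scalet _ _; set b := scalet _ _.
have m1 := measurableT_comp mG (measurable_shear1 a).
have m2 := measurableT_comp m1 (measurable_shear2 b).
etransitivity.
  exact: (ge0_integral_shear1 a (G := fun x => G (shear1 a (shear2 b x)))).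
etransitivity; first exact: (ge0_integral_shear2 b (G := fun x => G (shear1 a x))).
exact: ge0_integral_shear1.
Qed.

(** With t = cos theta, the shearing vector [scalet (1 + t)^-1 y] has length tan (theta / 2), as in
    the classical factorization of a plane rotation. Since |y|^2 = (1 - t)(1 + t), the denominators
    cancel in the head, where the two terms in p recombine to p. *)
Lemma rotation_tcons n (s t : R) (y x : n.-tuple R) :
  dotp (tcons (t, y)) (tcons (t, y)) = 1 -> 1 + t != 0 ->
  let p := dotp y x in
  rotation (tcons (t, y)) (tcons (s, x)) =
  tcons (t * s + p, addt x (scalet (- (s + p / (1 + t))) y)).
Proof.
move=> + t1 p.
rewrite dotp_tcons => /(canRL (addKr _)) y1.
rewrite /rotation /shear1 /shear2 !(thead_tcons, tbehead_tcons).
rewrite scaletA mulrN1 !dotpZl dotpDr dotpZr y1 -/p.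
by congr (tcons (_, addt _ (scalet _ _))); field.
Qed.

Lemma thead_rotation n (y x : n.+1.-tuple R) :
  dotp y y = 1 -> 1 + thead y != 0 -> thead (rotation y x) = dotp y x.
Proof.
have [[t y'] ->] : exists p, y = tcons p by exists (thead y, tbehead y); rewrite tcons_eta.
have [[s x'] ->] : exists p, x = tcons p by exists (thead x, tbehead x); rewrite tcons_eta.
rewrite thead_tcons => y1 yN1.
by rewrite rotation_tcons// thead_tcons dotp_tcons.
Qed.

Lemma dotp_rotation n (y x : n.+1.-tuple R) :
  dotp y y = 1 -> 1 + thead y != 0 ->
  dotp (rotation y x) (rotation y x) = dotp x x.
Proof.
have [[t y'] ->] : exists p, y = tcons p by exists (thead y, tbehead y); rewrite tcons_eta.
have [[s x'] ->] : exists p, x = tcons p by exists (thead x, tbehead x); rewrite tcons_eta.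
rewrite thead_tcons => y1 yN1.
rewrite rotation_tcons// !dotp_tcons; move: y1; rewrite dotp_tcons => /(canRL (addKr _)) y1.
rewrite dotpDr dotpZr 2!(dotpC (addt _ _)) !dotpDr !dotpZr y1 (dotpC x' y').
by field.
Qed.
End rotation.

(** * Integrals of zonal functions *)

Section surface_integral.
Context {R : realType}.
Implicit Types d : nat.
Local Notation mu := (@lebesgue_measure R).
Local Notation vol := (lebesgue_tuple R).

Lemma measurable_sphere d : measurable (sphere R d).
Proof.
rewrite (_ : sphere R d = (fun x => dotp x x) @^-1` [set 1]); last by [].
rewrite -[X in measurable X]setTI.
have m : measurable_fun setT (fun x : d.+1.-tuple R => dotp x x).
  by apply: measurable_dotp; exact: measurable_id.
by apply: m => //; exact: measurable_set1.
Qed.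

Local Notation pball d := [set x : d.+1.-tuple R | 0 < norm2 x <= 1].

Lemma dotp_norm2 n (x : n.-tuple R) : dotp x x = norm2 x ^+ 2.
Proof. by rewrite /norm2 sqr_sqrtr// dotp_ge0. Qed.

Lemma sphere_dir d (x : d.+1.-tuple R) : 0 < norm2 x -> sphere R d (dir x).
Proof.
move=> x0; rewrite /sphere /= /dir dotpZ dotp_norm2 expr2 mulrACA.
by rewrite mulVf ?gt_eqF// mulr1.
Qed.

Lemma ge0_integral_mrestr dT (T : measurableType dT)
    (m : {measure set T -> \bar R}) (B : set T) (mB : measurable B)
    (D : set T) (g : T -> \bar R) :
  measurable D -> measurable_fun D g -> (forall x, D x -> 0 <= g x)%E ->
  (\int[mrestr m mB]_(x in D) g x = \int[m]_(x in D `&` B) g x)%E.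
Proof.
move=> mD mg g0.
rewrite -{1}(setUIDK D B) ge0_integral_setU//; first last.
- by rewrite /disj_set; apply/eqP; rewrite setDE setIACA setICr setI0.
- by move=> x; rewrite setUIDK; exact: g0.
- by rewrite setUIDK.
- exact: measurableD.
- exact: measurableI.
rewrite [X in (_ + X)%E](_ : _ = 0)%E; last first.
  rewrite -(integral_measure_zero (D `\` B) g); apply: eq_measure_integral.
  move=> A mA AB; transitivity (m set0); last exact: measure0.
  congr (m _); by apply/seteqP; split => x // -[/AB[_ nB] /nB].
rewrite adde0; apply: eq_measure_integral => A mA AB.
transitivity (m (A `&` B)); first by [].
by rewrite setIidl// => x /AB[].
Qed.

(** By [coneE], the surface measure is d + 1 times the image under [dir] of Lebesgue measure on the
    punctured unit ball. *)
Lemma ge0_integral_surface d (g : d.+1.-tuple R -> \bar R) :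
  measurable_fun setT g -> (forall x, 0 <= g x)%E ->
  (\int[surface_measure R d]_(x in sphere R d) g x =
   d.+1%:R%:E * \int[vol d.+1]_(x in pball d) g (dir x))%E.
Proof.
move=> mg g0.
have mB := @measurable_punctured_ball R d.+1.
pose restr := mrestr (vol d.+1) mB.
pose push := @measure_function_pushforward__canonical__measure_function_Measure
  _ _ _ _ _ restr (@dir R d.+1) (@measurable_dir R d.+1).
pose m : {measure set (d.+1.-tuple R) -> \bar R} := mscale (NngNum (ler0n R d.+1)) push.
transitivity (\int[m]_(x in sphere R d) g x)%E.
  apply: eq_measure_integral => A mA _.
  by rewrite /m /mscale /= /surface_measure coneE setIC.
have mS := @measurable_sphere d.
have mgS : measurable_fun (sphere R d) g by exact: measurable_funTS.
rewrite (ge0_integral_mscale push mS (NngNum (ler0n R d.+1)) mgS (fun x _ => g0 x)).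
apply: (congr1 (mule _)).
have mD : measurable (@dir R d.+1 @^-1` sphere R d).
  by rewrite -[X in measurable X]setTI; exact: measurable_dir.
have mgd : measurable_fun (@dir R d.+1 @^-1` sphere R d) (g \o @dir R d.+1).
  by apply: measurable_funTS; exact: (measurableT_comp mg (@measurable_dir R d.+1)).
rewrite [LHS](@ge0_integral_pushforward _ _ _ _ R (@dir R d.+1)
  (@measurable_dir R d.+1) restr _ g mS mgS (fun x _ => g0 x)).
rewrite (ge0_integral_mrestr _ mB mD mgd (fun x _ => g0 _)).
by rewrite setIidr//= => x /= /andP[x0 _]; exact: sphere_dir.
Qed.

Lemma thead_dir n (x : n.+1.-tuple R) : thead (dir x) = (norm2 x)^-1 * thead x.
Proof. exact: tnth_mktuple. Qed.

(** A map that preserves volume and norm and turns x.y into the first coordinate moves the centre to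
    the first axis. The right-hand side no longer mentions [y]: this is the form in which rotation
    invariance is used. *)
Lemma ge0_integral_zonal_map d (y : d.+1.-tuple R)
    (T : d.+1.-tuple R -> d.+1.-tuple R) (g : R -> \bar R) :
  (forall G, measurable_fun setT G -> (forall x, 0 <= G x)%E ->
    (\int[vol d.+1]_x G (T x) = \int[vol d.+1]_x G x)%E) ->
  (forall x, dotp (T x) (T x) = dotp x x) -> (forall x, thead (T x) = dotp x y) ->
  measurable_fun setT g -> (forall x, 0 <= g x)%E ->
  (\int[surface_measure R d]_(x in sphere R d) g (dotp x y) =
   d.+1%:R%:E * \int[vol d.+1]_(x in pball d) g (thead (dir x)))%E.
Proof.
move=> iT dT hT mg g0; rewrite (ge0_integral_surface (g := fun x => g (dotp x y)))//.
  apply: (congr1 (mule _)).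
  rewrite [LHS]integral_mkcond [RHS]integral_mkcond.
  rewrite -[RHS](iT ((fun x => g (thead (dir x))) \_ (pball d))).
  - apply: eq_integral => x _; rewrite /patch.
    have nT : norm2 (T x) = norm2 x by rewrite /norm2 dT.
    have -> : (T x \in pball d) = (x \in pball d).
      by apply/idP/idP; rewrite !inE /= nT.
    by rewrite thead_dir hT nT /dir dotpZl.
  - apply/(measurable_restrictT _ _).1; first exact: measurable_punctured_ball.
    apply: measurable_funTS; apply: (measurableT_comp mg).
    apply: (measurableT_comp (@measurable_thead R d)); exact: measurable_dir.
  - by move=> x; apply: erestrict_ge0.
apply: (measurableT_comp mg); apply: measurable_dotp; first exact: measurable_id.
exact: measurable_cst.
Qed.

Lemma ge0_integral_zonal d (y : d.+1.-tuple R) (g : R -> \bar R) :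
  sphere R d y -> measurable_fun setT g -> (forall x, 0 <= g x)%E ->
  (\int[surface_measure R d]_(x in sphere R d) g (dotp x y) =
   d.+1%:R%:E * \int[vol d.+1]_(x in pball d) g (thead (dir x)))%E.
Proof.
move=> Sy mg g0; have [y0|y0] := leP 0 (thead y).
  have yN1 : 1 + thead y != 0 by rewrite gt_eqF// ltr_pwDl.
  apply: (ge0_integral_zonal_map (T := rotation y)) => //.
  - by move=> G mG G0; exact: ge0_integral_rotation.
  - by move=> x; rewrite dotp_rotation.
  - by move=> x; rewrite thead_rotation// dotpC.
(* [rotation] divides by 1 + its head, which vanishes at the point opposite to the first basis
   vector. For a negative head, [- y] is rotated instead: the image of x then has head - x.y, and
   [flip] restores the sign. *)
pose z := scalet (-1) y.
have z0 : thead z = - thead y by rewrite /z /thead tnth_mktuple mulN1r.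
have Sz : dotp z z = 1 by rewrite /z dotpZ mulrNN !mul1r.
have zN1 : 1 + thead z != 0 by rewrite gt_eqF// z0 ltr_pwDl// oppr_ge0 ltW.
apply: (ge0_integral_zonal_map (T := fun x => flip (rotation z x))) => //.
- move=> G mG G0.
  rewrite -[RHS]ge0_integral_flip// -[RHS](ge0_integral_rotation z)//.
  by apply: (measurableT_comp mG); exact: measurable_flip.
- move=> x; rewrite -[RHS](dotp_rotation x Sz zN1) -{3 4}(tcons_eta (rotation z x)).
  by rewrite /flip !dotp_tcons mulrNN.
- by move=> x; rewrite /flip thead_tcons thead_rotation// /z dotpZl mulN1r opprK dotpC.
Qed.
End surface_integral.

(** * Spherical caps *)

Section caps.
Context {R : realType}.
Implicit Types d n : nat.
Local Notation mu := (@lebesgue_measure R).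
Local Notation vol := (lebesgue_tuple R).
Local Notation pball d := [set x : d.+1.-tuple R | (0 < norm2 x <= 1)%R].

Definition cube n (r : R) : set (n.-tuple R)  :=
  [set x | forall i, - r <= tnth x i <= r].
Arguments cube : clear implicits.

Lemma cubeS n (r : R) : cube n.+1 r =
  [set x | [set` `[- r, r]] (thead x) /\ cube n r [tuple of behead x]].
Proof.
apply/seteqP; split=> x /=.
  move=> bx; split=> [|i].
    by rewrite in_itv /= /thead; exact: bx.
  by have := bx (lift ord0 i); rewrite {1 2}(tuple_eta x) !tnthS.
rewrite in_itv /= => -[x0 bx] i; case: (unliftP ord0 i) => [j|] ->//.
by rewrite (tuple_eta x) tnthS; exact: bx.
Qed.

Lemma measurable_cube n (r : R) : measurable (cube n r).
Proof.
elim: n => [|n IH]; last by rewrite cubeS; exact: measurable_thead_behead.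
by rewrite (_ : cube 0 r = setT)//; apply/seteqP; split=> // x _ [].
Qed.

Lemma lebesgue_measure_segment (a b : R) : a <= b -> mu `[a, b]%classic = (b - a)%:E.
Proof.
rewrite le_eqVlt => /predU1P[->|ab].
  by rewrite set_itv1 lebesgue_measure_set1 subrr.
by rewrite lebesgue_measure_itv /= lte_fin ab.
Qed.

Lemma lebesgue_tuple_cube n (r : R) : 0 <= r -> vol n (cube n r) = ((2 * r) ^+ n)%:E.
Proof.
move=> r0; elim: n => [|n IH].
  rewrite /= diracE expr0 (_ : _ \in _ = true)//.
  by apply/mem_set => -[].
rewrite cubeS [LHS](lebesgue_consE (vol n)) //; last exact: measurable_cube.
rewrite IH lebesgue_measure_segment; last by rewrite (le_trans _ r0)// oppr_le0.
by rewrite -EFinM exprS opprK; congr (_ * _)%:E; ring.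
Qed.

Definition slab d (a b r : R) : set (d.+1.-tuple R) :=
  [set x | [set` `[a, b]] (thead x) /\ cube d r [tuple of behead x]].
Arguments slab : clear implicits.

Lemma measurable_slab d (a b r : R) : measurable (slab d a b r).
Proof. by apply: measurable_thead_behead => //; exact: measurable_cube. Qed.

Lemma lebesgue_tuple_slab d (a b r : R) : a <= b -> 0 <= r ->
  vol d.+1 (slab d a b r) = ((b - a) * (2 * r) ^+ d)%:E.
Proof.
move=> ab r0; rewrite [LHS](lebesgue_consE (vol d)) //; last exact: measurable_cube.
by rewrite [X in (_ * X)%E]lebesgue_tuple_cube// lebesgue_measure_segment// EFinM.
Qed.

Lemma surface_measure_zonal d (y : d.+1.-tuple R) (A : set R) :
  sphere R d y -> measurable A ->
  surface_measure R d (sphere R d `&` [set x | A (dotp x y)]) =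
  (d.+1%:R%:E * vol d.+1 (pball d `&` [set x | A (thead (dir x))]))%E.
Proof.
move=> Sy mA.
have mfA : measurable_fun setT (fun t => (\1_A t)%:E : \bar R).
  by apply/measurable_EFinP; exact: measurable_indic.
have fA0 t : (0 <= (\1_A t)%:E :> \bar R)%E by rewrite lee_fin.
have := ge0_integral_zonal Sy mfA fA0.
have mS := @measurable_sphere R d.
have mB := @measurable_punctured_ball R d.+1.
have mA1 : measurable [set x | A (dotp x y)].
  rewrite -[X in measurable X]setTI.
  suff m : measurable_fun setT (fun x => dotp x y) by exact: m.
  by apply: measurable_dotp; [exact: measurable_id|exact: measurable_cst].
have mA2 : measurable [set x : d.+1.-tuple R | A (thead (dir x))].
  rewrite -[X in measurable X]setTI.
  suff m : measurable_fun setT (fun x : d.+1.-tuple R => thead (dir x)) by exact: m.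
  exact: (measurableT_comp (@measurable_thead R d) (@measurable_dir R d.+1)).
move=> E.
transitivity (\int[surface_measure R d]_(x in sphere R d) (\1_A (dotp x y))%:E)%E.
  rewrite setIC; exact/esym/(integral_indic _ mS mA1).
rewrite E setIC; apply: (congr1 (mule _)); exact: (integral_indic _ mB mA2).
Qed.

Lemma dotp_tcons_eta n (x : n.+1.-tuple R) :
  dotp x x = thead x ^+ 2 + dotp (tbehead x) (tbehead x).
Proof. by rewrite -{1 2}(tcons_eta x) dotp_tcons -expr2. Qed.

Lemma dotp_cube n (r : R) (x : n.-tuple R) : cube n r x -> dotp x x <= n%:R * r ^+ 2.
Proof.
move=> xr; rewrite /dotp (@le_trans _ _ (\sum_(i < n) r ^+ 2))//.
  apply: ler_sum => i _; rewrite -expr2 -real_normK ?num_real//.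
  have xri : `|tnth x i| <= r by rewrite ler_norml xr.
  by rewrite lerXn2r// nnegrE (le_trans _ xri).
by rewrite sumr_const card_ord mulr_natl.
Qed.

(** The cone over the cap contains, after rotation, the points with head in [1/4, 1/2] and other
    coordinates at most k r in absolute value. This slab has volume of order r^d, and the directions
    of its points stay within O(r) of the first axis. *)
Lemma cap_ge d (y : d.+1.-tuple R) : sphere R d y ->
  exists2 c : R, 0 < c & forall r, 0 < r <= 1 ->
    ((c * r ^+ d)%:E <=
     surface_measure R d (sphere R d `&` [set x | (1 - r ^+ 2 <= dotp x y)%R]))%E.
Proof.
(* This k gives d (k r)^2 <= r^2 / 64 for the squared norm of the tail, that is, at most r^2 / 4
   times the squared head, which is at least 1/16. *)
move=> Sy; pose k : R := (8 * d.+1%:R)^-1.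
have k0 : 0 < k by rewrite invr_gt0 mulr_gt0// ltr0n.
exists (d.+1%:R * (4^-1 * (2 * k) ^+ d)).
  by rewrite !mulr_gt0 ?exprn_gt0 ?mulr_gt0 ?invr_gt0 ?ltr0n.
move=> r /andP[r0 r1].
rewrite (_ : [set x | _] = [set x | [set` `[1 - r ^+ 2, +oo[] (dotp x y)]); last first.
  by apply/seteqP; split => x; rewrite /= in_itv/= andbT.
rewrite surface_measure_zonal//.
rewrite -mulrA EFinM lee_pmul2l// ?lte_fin ?ltr0n//.
have := @lebesgue_tuple_slab d 4^-1 2^-1 (k * r) _ _.
rewrite (_ : (2^-1 - 4^-1) * _ = 4^-1 * (2 * k) ^+ d * r ^+ d); last first.
  by rewrite -mulrA -exprMn mulrA; congr (_ * _); field.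
rewrite lef_pV2 ?posrE ?ltr0n// ler_nat => /(_ isT) <-; last by rewrite mulr_ge0 ?ltW.
apply: le_measure; rewrite ?inE.
- exact: measurable_slab.
- apply: measurableI; first exact: measurable_punctured_ball.
  rewrite -[X in measurable X]setTI.
  suff m : measurable_fun setT (fun x : d.+1.-tuple R => thead (dir x)) by exact: m.
  exact: (measurableT_comp (@measurable_thead R d) (@measurable_dir R d.+1)).
move=> x [/=]; rewrite in_itv/= => /andP[x4 x2] /dotp_cube.
set q := dotp _ _ => q_le.
have {}q_le : q <= r ^+ 2 / 64.
  apply: le_trans q_le _; rewrite exprMn mulrA mulrC ler_wpM2l ?sqr_ge0//.
  have dd : d%:R <= d.+1%:R :> R by rewrite ler_nat.
  have d1 : 1 <= d.+1%:R :> R by rewrite ler1n.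
  have kD : k * d.+1%:R = 8^-1 by rewrite /k; field; rewrite addr_eq0; lra.
  have k8 : k <= 8^-1 by rewrite -kD ler_peMr// ltW.
  have h : d%:R * k <= 8^-1 by rewrite -kD mulrC ler_pM2l.
  rewrite expr2 mulrA (le_trans (ler_wpM2r (ltW k0) h))//; lra.
have q0 : 0 <= q by exact: dotp_ge0.
have xx : dotp x x = thead x ^+ 2 + q by exact: dotp_tcons_eta.
have r21 : r ^+ 2 <= 1 by rewrite expr_le1// ltW.
have n0 : 0 < norm2 x.
  rewrite /norm2 sqrtr_gt0 xx ltr_wpDr// exprn_gt0//; lra.
have n2 : norm2 x ^+ 2 = thead x ^+ 2 + q by rewrite -dotp_norm2.
split => /=.
  rewrite n0 /= -(@ler_pXn2r _ 2)// ?nnegrE ?(ltW n0)// n2; nra.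
rewrite in_itv /= andbT thead_dir mulrC ler_pdivlMr//.
have t0 : 0 <= thead x by lra.
rewrite -(@ler_pXn2r _ 2)// ?nnegrE ?mulr_ge0 ?(ltW n0) ?subr_ge0//.
rewrite exprMn n2; move: r21 q_le (sqr_ge0 r); set u := r ^+ 2 => u1 qu u0.
have : 16^-1 <= thead x ^+ 2 by nra.
set p := thead x ^+ 2 => p16.
have h0 : 0 <= u * (p - 16^-1) by rewrite mulr_ge0// subr_ge0.
(* The goal is (1 - u)^2 (p + q) <= p. One factor 1 - u already suffices, because q <= u / 64 <= u p
   / 4. *)
have h1 : (1 - u) * (p + q) <= p by have := mulr_ge0 u0 q0; nra.
apply: (le_trans _ h1); have pq : 0 <= p + q by lra.
have u10 : 0 <= 1 - u by rewrite subr_ge0.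
by rewrite expr2 -mulrA ler_piMl ?mulr_ge0// gerBl.
Qed.

(** With del = r^2 / 2, a point of the unit ball whose direction lies in one of the two caps has
    tail of norm at most r, so it lies in a slab of volume 2 (2 r)^d. Here d >= 1 matters: it gives
    r^d <= r, whereas for d = 0 the two caps are the whole sphere. *)
Lemma caps_cvg0 d (y : d.+1.-tuple R) (e : R) : (1 <= d)%N -> sphere R d y ->
  0 < e -> exists2 del : R, 0 < del < 1 &
  (surface_measure R d (sphere R d `&` [set x | (1 - del < `|dotp x y|)%R]) <= e%:E)%E.
Proof.
move=> d1 Sy e0.
pose K : R := d.+1%:R * (2 * 2 ^+ d).
have K0 : 0 < K by rewrite !mulr_gt0 ?exprn_gt0 ?ltr0n.
pose r := Num.min 1 (e / K).
have r0 : 0 < r by rewrite lt_min ltr01 divr_gt0.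
have r1 : r <= 1 by rewrite ge_min lexx.
have re : K * r <= e by rewrite mulrC -ler_pdivlMr// ge_min lexx orbT.
have r21 : r ^+ 2 <= 1 by rewrite expr_le1// ltW.
exists (r ^+ 2 / 2).
  have : 0 < r ^+ 2 by rewrite exprn_gt0.
  lra.
rewrite (_ : [set x | _] = [set x | (~` [set` `[- (1 - r ^+ 2 / 2), 1 - r ^+ 2 / 2]]) (dotp x y)]); last first.
  apply/seteqP; split => x; rewrite /= in_itv/= -ler_norml.
    by move=> h /(lt_le_trans h); rewrite ltxx.
  by move=> /negP; rewrite -ltNge.
rewrite surface_measure_zonal//; last exact: measurableC.
apply: (@le_trans _ _ (K * r)%:E); last by rewrite lee_fin.
apply: (@le_trans _ _ (d.+1%:R * ((1 - (-1)) * (2 * r) ^+ d))%:E); last first.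
  rewrite lee_fin /K -!mulrA ler_wpM2l ?ler0n// (_ : 1 - -1 = 2)// ?opprK//.
  rewrite ler_pM2l// exprMn ler_wpM2l ?exprn_ge0//.
  by rewrite -{2}(expr1 r) ler_wiXn2l// ltW.
rewrite EFinM lee_pmul2l// ?lte_fin ?ltr0n//.
have N11 : -1 <= 1 :> R by lra.
rewrite -(@lebesgue_tuple_slab d (-1) 1 r N11 (ltW r0)).
apply: le_measure; rewrite ?inE.
- apply: measurableI; first exact: measurable_punctured_ball.
  rewrite -[X in measurable X]setTI.
  suff m : measurable_fun setT (fun x : d.+1.-tuple R => thead (dir x)).
    by apply: m => //; exact: measurableC.
  exact: (measurableT_comp (@measurable_thead R d) (@measurable_dir R d.+1)).
- exact: measurable_slab.
move=> x [/= /andP[n0 n1]]; rewrite in_itv/= -ler_norml thead_dir => /negP.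
rewrite -ltNge normrM gtr0_norm ?invr_gt0// [X in _ < X]mulrC ltr_pdivlMr// => h.
have xx : norm2 x ^+ 2 = thead x ^+ 2 + dotp (tbehead x) (tbehead x).
  by rewrite -dotp_norm2; exact: dotp_tcons_eta.
have q0 := dotp_ge0 (tbehead x).
have n21 : norm2 x ^+ 2 <= 1 by rewrite expr_le1// ltW.
split.
  rewrite /= in_itv/= -ler_norml -(@ler_pXn2r _ 2)// ?nnegrE// expr1n real_normK ?num_real//.
  by apply: le_trans n21; rewrite xx lerDl.
have : dotp (tbehead x) (tbehead x) <= r ^+ 2.
  have : ((1 - r ^+ 2 / 2) * norm2 x) ^+ 2 <= thead x ^+ 2.
    rewrite -[leRHS]real_normK ?num_real// lerXn2r ?nnegrE ?mulr_ge0 ?(ltW n0) ?(ltW h)//; lra.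
  rewrite exprMn xx; move: n21; rewrite xx.
  move: r21 q0 (sqr_ge0 r) (sqr_ge0 (thead x)); set q := dotp _ _; set u := r ^+ 2; set t := _ ^+ 2 => *.
  nra.
move=> qr i; rewrite -ler_norml -(@ler_pXn2r _ 2)// ?nnegrE ?(ltW r0)// real_normK ?num_real//.
apply: le_trans qr; rewrite /dotp (bigD1 i)//= -expr2 lerDl.
by apply: sumr_ge0 => j _; rewrite -expr2 sqr_ge0.
Qed.
End caps.
Arguments cube {R} n r.

(** * Density of the zonal coordinate away from the poles *)

Section far.
Context {R : realType}.
Local Notation mu := (@lebesgue_measure R).

Definition hyp (r t : R) : R := Num.sqrt (t ^+ 2 + r ^+ 2).

Lemma hyp_gt0 r t : 0 < r -> 0 < hyp r t.
Proof. by move=> r0; rewrite sqrtr_gt0 ltr_wpDl ?sqr_ge0// exprn_gt0. Qed.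

Lemma sqr_hyp r t : hyp r t ^+ 2 = t ^+ 2 + r ^+ 2.
Proof. by rewrite sqr_sqrtr// addr_ge0 ?sqr_ge0. Qed.

(* N (1 - cos theta) for the angle theta at the origin between the first axis
   and the point (t, y) with |y| = r. *)
Definition profile (N r t : R) : R := (1 - t / hyp r t) * N.

Lemma is_derive_profile (N r t : R) : 0 < r ->
  is_derive t (1 : R) (profile N r) (- (N * r ^+ 2 / hyp r t ^+ 3)).
Proof.
move=> r0; have h0 := hyp_gt0 t r0.
have D2 : is_derive t (1 : R) (fun t : R => t ^+ 2 + r ^+ 2) (2 * t).
  have D := is_deriveD (is_deriveX 2 (is_derive_id t (1 : R)))
    (is_derive_cst (r ^+ 2) t (1 : R)).
  apply: (is_derive_eq D).
  by rewrite addr0 expr1 -[_ *: _]/(_ * _) mulr1.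
have p0 : 0 < t ^+ 2 + r ^+ 2 by rewrite ltr_wpDl ?sqr_ge0// exprn_gt0.
have D3 := @is_derive1_comp _ _ (fun t : R => t ^+ 2 + r ^+ 2) _ _ _ (is_derive1_sqrt p0) D2.
have D4 := @is_deriveV _ (hyp r) _ _ _ (lt0r_neq0 h0) D3.
have D5 := is_deriveM (is_derive_id t (1 : R)) D4.
have D6 := is_deriveZ N (is_deriveB (is_derive_cst (1 : R) t (1 : R)) D5).
rewrite (_ : profile N r = N \*: (cst 1 - (id * (fun x => (hyp r x)^-1)))); last first.
  by apply/funext => x; rewrite /profile mulrC.
apply: (is_derive_eq D6).
rewrite /= -!/(hyp r t) /GRing.scale /= sub0r mulr1 invfM.
have e : t ^+ 2 = hyp r t ^+ 2 - r ^+ 2 by rewrite sqr_hyp addrK.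
have hn : hyp r t != 0 by rewrite gt_eqF.
have -> : N * r ^+ 2 / hyp r t ^+ 3 = N * (hyp r t ^+ 2 - t ^+ 2) / hyp r t ^+ 3.
  by rewrite e subKr.
by field.
Qed.

Lemma hyp_le (r t del : R) : 0 < r -> 0 < del <= 1 -> `|t| <= r / del ->
  hyp r t <= 2 * r / del.
Proof.
move=> r0 /andP[d0 d1] tr; have rd0 : 0 < r / del by rewrite divr_gt0.
rewrite -(@ler_pXn2r _ 2)// ?nnegrE ?(ltW (hyp_gt0 t r0)) ?mulr_ge0 ?(ltW r0) ?invr_ge0 ?(ltW d0)//.
rewrite sqr_hyp -mulrA exprMn.
have : t ^+ 2 <= (r / del) ^+ 2 by rewrite -real_normK ?num_real// lerXn2r// nnegrE ltW.
have : r ^+ 2 <= (r / del) ^+ 2.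
  by rewrite lerXn2r ?nnegrE ?(ltW r0) ?(ltW rd0)// ler_pdivlMr// ler_piMr// ltW.
have := sqr_ge0 (r / del); lra.
Qed.

Lemma profile_decreasing (N r s t : R) : 0 < N -> 0 < r -> s < t ->
  profile N r t < profile N r s.
Proof.
move=> N0 r0 st.
have D x : is_derive x (1 : R) (profile N r) (- (N * r ^+ 2 / hyp r x ^+ 3)).
  exact: is_derive_profile.
have C x : {for x, continuous (profile N r)}.
  by apply: differentiable_continuous; apply/derivable1_diffP; case: (D x).
have [c _ e] := MVT st (fun x _ => D x) (continuous_subspaceT C).
rewrite -subr_lt0 e mulNr oppr_lt0 mulr_gt0 ?subr_gt0//.
by rewrite divr_gt0 ?mulr_gt0 ?exprn_gt0// hyp_gt0.
Qed.

(** At t = r / del the cosine is 1 / sqrt (1 + del^2), which is at most 1 - del^2 / 4 because (1 - u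
    / 4)^2 (1 + u) >= 1 for u in [0, 1]. *)
Lemma profile_ge (N r del : R) : 0 < N -> 0 < r -> 0 < del <= 1 ->
  del ^+ 2 * N / 4 <= profile N r (r / del).
Proof.
move=> N0 r0 /andP[d0 d1]; have h0 := hyp_gt0 (r / del) r0.
have key : r / del / hyp r (r / del) <= 1 - del ^+ 2 / 4.
  have u1 : del ^+ 2 <= 1 by rewrite expr_le1// ltW.
  have u0 := sqr_ge0 del.
  have w0 : 0 <= 1 - del ^+ 2 / 4 by lra.
  rewrite ler_pdivrMr// -(@ler_pXn2r _ 2)// ?nnegrE ?mulr_ge0 ?invr_ge0 ?(ltW r0) ?(ltW h0) ?(ltW d0)//.
  rewrite [leRHS]exprMn sqr_hyp.
  have e : r ^+ 2 = del ^+ 2 * (r / del) ^+ 2.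
    by rewrite -exprMn mulrC divfK// gt_eqF.
  rewrite e; move: (del ^+ 2) ((r / del) ^+ 2) (sqr_ge0 (r / del)) u0 u1.
  move=> u T T0 u0 u1.
  rewrite (_ : _ * _ = ((1 - u / 4) ^+ 2 * (1 + u)) * T); last by ring.
  rewrite ler_peMl//.
  have : 0 <= u * (1 - u) by rewrite mulr_ge0// subr_ge0.
  have : 0 <= u * u * u by rewrite !mulr_ge0.
  have : 0 <= u * u by rewrite !mulr_ge0.
  nra.
rewrite /profile (_ : del ^+ 2 * N / 4 = del ^+ 2 / 4 * N); last by ring.
rewrite ler_pM2r//; lra.
Qed.

(** Substitution s = [profile N r t]. On the interval, [hyp_le] bounds the absolute derivative N r^2
    / hyp^3 below by N del^3 / (8 r), hence by N del^3 / 8 since r <= 1: the estimate is uniform in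
    r. The profile decreases, so s is at least its value at the right endpoint, which [profile_ge]
    bounds below. *)
Lemma integral_profile_le (phi : R -> R) (N r del : R) :
  continuous phi -> (forall s, 0 <= phi s) ->
  0 < N -> 0 < r <= 1 -> 0 < del <= 1 ->
  (\int[mu]_(t in `[(- (r / del))%R, (r / del)%R]) (phi (profile N r t))%:E <=
   (8 / (del ^+ 3 * N))%:E *
     \int[mu]_(s in `[(del ^+ 2 * N / 4)%R, +oo[) (phi s)%:E)%E.
Proof.
move=> cphi phi0 N0 /andP[r0 r1] /[dup] d01 /andP[d0 d1].
set T := r / del; have T0 : 0 < T by rewrite divr_gt0.
pose F := profile N r; pose dF t := - (N * r ^+ 2 / hyp r t ^+ 3).
have D x : is_derive x (1 : R) F (dF x) by exact: is_derive_profile.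
have F'E : derive1 F = dF.
  by apply/funext => x; rewrite derive1E; exact: derive_val.
have cF : continuous F.
  by move=> x; apply: differentiable_continuous; apply/derivable1_diffP; case: (D x).
have dF0 x : 0 <= - dF x.
  by rewrite /dF opprK ltW// divr_gt0 ?mulr_gt0 ?exprn_gt0// hyp_gt0.
have chyp : continuous (hyp r).
  move=> x; apply: (@continuous_comp _ _ _ (fun t : R => t ^+ 2 + r ^+ 2) (@Num.sqrt R)).
    by apply: cvgD; [exact: exprn_continuous|exact: cvg_cst].
  exact: sqrt_continuous.
have cdF : continuous dF.
  move=> x; apply: cvgN; apply: cvgM; first exact: cvg_cst.
  apply: cvgV.
    by rewrite expf_neq0// gt_eqF// hyp_gt0.
  apply: (@continuous_comp _ _ _ (hyp r) (fun t : R => t ^+ 3)); first exact: chyp.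
  exact: exprn_continuous.
have sub := @integration_by_substitution_decreasing R F phi (- T) T.
have {sub} sub : (\int[mu]_(x in `[F T, F (- T)%R]) (phi x)%:E =
  \int[mu]_(x in `[(- T)%R, T]) (((phi \o F) * - derive1 F) x)%:E)%E.
  apply: sub.
  - by rewrite (le_trans _ (ltW T0))// oppr_le0 ltW.
  - by move=> x y _ _; exact: profile_decreasing.
  - by rewrite F'E => x _; exact: cdF.
  - by rewrite F'E; apply: cvgP; apply: cvg_at_right_filter; exact: cdF.
  - by rewrite F'E; apply: cvgP; apply: cvg_at_left_filter; exact: cdF.
  - split; [by move=> x _; case: (D x)|apply: cvg_at_right_filter|apply: cvg_at_left_filter]; exact: cF.
  - exact: continuous_subspaceT.
have mphi : measurable_fun setT phi by exact: continuous_measurable_fun.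
have mF : measurable_fun setT F by exact: continuous_measurable_fun.
have mdF : measurable_fun setT dF by exact: continuous_measurable_fun.
have k0 : 0 <= 8 / (del ^+ 3 * N) by rewrite divr_ge0// mulr_ge0 ?exprn_ge0 ?ltW.
apply: (@le_trans _ _ ((8 / (del ^+ 3 * N))%:E *
  \int[mu]_(x in `[(- T)%R, T]) (((phi \o F) * - derive1 F) x)%:E)%E).
  have I0 x : (0 <= (((phi \o F) * - derive1 F) x)%:E)%E.
    by rewrite lee_fin F'E; exact: mulr_ge0 (phi0 _) (dF0 _).
  have mI : measurable_fun `[- T, T] (fun x => (((phi \o F) * - derive1 F) x)%:E).
    rewrite F'E; apply/measurable_EFinP; apply: measurable_funTS.
    apply: measurable_funM; first exact: measurableT_comp.
    exact: measurableT_comp.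
  rewrite -(ge0_integralZl_EFin _ _ _ _ k0)//.
  apply: ge0_le_integral => //.
  - by move=> x _; rewrite lee_fin.
  - by apply/measurable_EFinP; apply: measurable_funTS; exact: measurableT_comp.
  - exact: measurable_funeM.
  move=> x; rewrite /= in_itv/= -ler_norml => xT; rewrite -EFinM lee_fin F'E.
  rewrite [X in _ <= X](_ : _ = phi (F x) * (8 / (del ^+ 3 * N) * - dF x)); last first.
    by rewrite /= mulrCA.
  rewrite ler_peMr// /dF opprK.
  have h0 := hyp_gt0 x r0.
  have h3 : hyp r x ^+ 3 <= 8 * r ^+ 2 / del ^+ 3.
    have := hyp_le r0 d01 xT; rewrite -(@ler_pXn2r _ 3)// ?nnegrE ?(ltW h0)//; last first.
      by rewrite divr_ge0 ?mulr_ge0 ?(ltW r0) ?(ltW d0).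
    move=> /le_trans; apply; rewrite !exprMn exprVn ler_wpM2r ?invr_ge0 ?exprn_ge0 ?(ltW d0)//.
    rewrite -natrX ler_wpM2l// ?ler_wiXn2l ?(ltW r0)//.
  rewrite (_ : 8 / (del ^+ 3 * N) * (N * r ^+ 2 / hyp r x ^+ 3) = 8 * r ^+ 2 / del ^+ 3 / hyp r x ^+ 3); last first.
    by field; rewrite !gt_eqF.
  by rewrite ler_pdivlMr ?exprn_gt0// mul1r.
rewrite -sub lee_pmul2l//; last by rewrite lte_fin divr_gt0 ?mulr_gt0 ?exprn_gt0.
apply: ge0_subset_integral => //.
- by apply/measurable_EFinP; exact: measurable_funTS.
- by move=> x _; rewrite lee_fin.
move=> x /=; rewrite !in_itv/= andbT => /andP[+ _]; apply: le_trans.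
exact: profile_ge.
Qed.

End far.

(** * Zonal integrals over the middle zone of the sphere *)

Section far_sphere.
Context {R : realType}.
Local Notation mu := (@lebesgue_measure R).
Local Notation vol := (lebesgue_tuple R).
Local Notation pball d := [set x : d.+1.-tuple R | (0 < norm2 x <= 1)%R].

Lemma norm2_tcons n (t : R) (y : n.-tuple R) : norm2 (tcons (t, y)) = hyp (norm2 y) t.
Proof. by rewrite /norm2 /hyp dotp_tcons sqr_sqrtr ?dotp_ge0. Qed.

Lemma norm2_cube n (y : n.-tuple R) : norm2 y <= 1 -> cube n 1 y.
Proof.
move=> y1 i; rewrite -ler_norml; apply: le_trans y1.
rewrite /norm2 -sqrtr_sqr ler_wsqrtr// /dotp (bigD1 i)//= -expr2 lerDl.
by apply: sumr_ge0 => j _; rewrite -expr2 sqr_ge0.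
Qed.

(** The ball is sliced by the lines {(t, z)} with z fixed. On such a line the condition |cos| <= 1 -
    del forces |t| <= |z| / del, so [integral_profile_le] applies with r = |z|, uniformly in z. The
    lines that meet the ball have z in the cube of volume 2^d. *)
Lemma integral_middle_le d (y : d.+1.-tuple R) (phi : R -> R) (N del : R) :
  sphere R d y -> continuous phi -> (forall s, 0 <= phi s) ->
  0 < N -> 0 < del <= 1 ->
  (\int[surface_measure R d]_(x in sphere R d)
      (phi ((1 - dotp x y) * N) * \1_[set` `[(- (1 - del))%R, (1 - del)%R]] (dotp x y))%:E
   <= (d.+1%:R * (8 / del ^+ 3) * 2 ^+ d / N)%:E *
     \int[mu]_(s in `[(del ^+ 2 * N / 4)%R, +oo[) (phi s)%:E)%E.
Proof.
move=> Sy cphi phi0 N0 /[dup] d01 /andP[d0 d1].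
pose J : set R := [set` `[- (1 - del), 1 - del]].
have mJ : measurable J by exact: measurable_itv.
pose g t : \bar R := (phi ((1 - t) * N) * \1_J t)%:E.
have mphi : measurable_fun setT phi by exact: continuous_measurable_fun.
have mg : measurable_fun setT g.
  apply/measurable_EFinP; apply: measurable_funM; last exact: measurable_indic.
  apply: (measurableT_comp mphi); apply: measurable_funM => //.
  by apply: measurable_funB => //; exact: measurable_cst.
have g0 t : (0 <= g t)%E by rewrite lee_fin mulr_ge0// indicE.
rewrite [leLHS](ge0_integral_zonal Sy mg g0).
pose G := (fun x : d.+1.-tuple R => g (thead (dir x))) \_ (pball d).
have mG : measurable_fun setT G.
  apply/(measurable_restrictT _ _).1; first exact: measurable_punctured_ball.
  apply: measurable_funTS; apply: (measurableT_comp mg).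
  apply: (measurableT_comp (@measurable_thead R d)); exact: measurable_dir.
have G0 x : (0 <= G x)%E by apply: erestrict_ge0.
rewrite integral_mkcond -/G (integral_lebesgue_tupleS mG G0).
set I := (\int[mu]_(s in _) _)%E.
have I0 : (0 <= I)%E by apply: integral_ge0 => s _; rewrite lee_fin.
pose K := ((8 / (del ^+ 3 * N))%:E * I)%E.
have K0 : (0 <= K)%E.
  by rewrite mule_ge0// lee_fin divr_ge0 ?mulr_ge0 ?exprn_ge0 ?ltW.
have KI0 (z : d.-tuple R) : (0 <= K * (\1_(cube d 1) z)%:E)%E.
  by apply: mule_ge0 => //; rewrite lee_fin indicE.
have mGy (z : d.-tuple R) : measurable_fun setT (fun t => G (tcons (t, z))).
  by apply: (measurableT_comp mG); exact: measurable_fun_tcons.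
have inner (z : d.-tuple R) :
    (\int[mu]_t G (tcons (t, z)) <= K * (\1_(cube d 1) z)%:E)%E.
  have nz0 : 0 <= norm2 z by exact: sqrtr_ge0.
  have nzE t : norm2 (tcons (t, z)) = hyp (norm2 z) t by exact: norm2_tcons.
  have thE t : thead (dir (tcons (t, z))) = t / hyp (norm2 z) t.
    by rewrite thead_dir nzE thead_tcons mulrC.
  (* Two degenerate lines contribute nothing: those with |z| > 1 miss the ball, and on the axis z =
     0 the cosine is 1 or -1, outside [J]. *)
  have [z1|z1] := ltP 1 (norm2 z).
    rewrite integral0_eq ?KI0// => t _.
    rewrite /G patchE memNset//= nzE => /andP[_]; apply/negP; rewrite -ltNge.
    apply: (lt_le_trans z1); rewrite -{1}(ger0_norm nz0) -sqrtr_sqr /hyp ler_wsqrtr//.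
    by rewrite lerDr sqr_ge0.
  have [z0|z0] := eqVneq (norm2 z) 0.
    rewrite integral0_eq ?KI0// => t _.
    rewrite /G patchE; case: ifPn => //; rewrite inE /= nzE => /andP[h0 _].
    rewrite /g thE indicE memNset ?mulr0// /J /= in_itv/= -ler_norml.
    rewrite /hyp z0 expr0n addr0 sqrtr_sqr in h0 *.
    rewrite normrM normfV normr_id mulfV ?gt_eqF//; lra.
  have r0 : 0 < norm2 z by rewrite lt_neqAle eq_sym z0.
  rewrite indicE mem_set ?mule1; last exact: norm2_cube.
  have r01 : 0 < norm2 z <= 1 by rewrite r0.
  apply: le_trans (integral_profile_le cphi phi0 N0 r01 d01).
  have mP : measurable_fun setT (fun t => (phi (profile N (norm2 z) t))%:E).
    apply/measurable_EFinP; apply: (measurableT_comp mphi).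
    apply: continuous_measurable_fun => x; apply: differentiable_continuous.
    by apply/derivable1_diffP; case: (is_derive_profile N x r0).
  rewrite [leRHS]integral_mkcond; apply: ge0_le_integral => //.
  - exact: mGy.
  - apply/(measurable_restrictT _ _).1; first exact: measurable_itv.
    exact: (measurable_funTS mP).
  move=> t _; rewrite /G !patchE; case: ifPn => _; last first.
    by case: ifPn => // _; rewrite lee_fin.
  rewrite /g thE -/(profile N (norm2 z) t) indicE.
  have [tJ|tJ] := boolP (t / hyp (norm2 z) t \in J); last first.
    by rewrite mulr0; case: ifPn => // _; rewrite lee_fin.
  rewrite mulr1 mem_set//= in_itv/= -ler_norml.
  have h0 := hyp_gt0 t r0.
  move: tJ; rewrite inE /J/= in_itv/= -ler_norml normrM normfV (gtr0_norm h0).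
  rewrite ler_pdivrMr// => ht.
  rewrite ler_pdivlMr// -(@ler_pXn2r _ 2)// ?nnegrE ?mulr_ge0// ?(ltW d0)//.
  (* Squaring gives t^2 del (2 - del) <= (1 - del)^2 |z|^2, and del^2 <= del (2 - del), whence t^2
     del^2 <= |z|^2. *)
  have : `|t| ^+ 2 <= ((1 - del) * hyp (norm2 z) t) ^+ 2.
    rewrite lerXn2r// nnegrE// mulr_ge0 ?(ltW h0)// subr_ge0//.
  rewrite [X in _ <= X -> _]exprMn sqr_hyp exprMn real_normK ?num_real//.
  have := sqr_ge0 t; have := sqr_ge0 (norm2 z).
  move: (t ^+ 2) (norm2 z ^+ 2) => a b b0 a0 ab.
  have : 0 <= (1 - del) * a * del by rewrite !mulr_ge0 ?(ltW d0)// subr_ge0.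
  have : 0 <= b * (2 - del) * del by rewrite !mulr_ge0 ?(ltW d0)//; lra.
  nra.
have mC : measurable_fun setT (fun z : d.-tuple R => (\1_(cube d 1) z)%:E : \bar R).
  by apply/measurable_EFinP; apply: measurable_indic; exact: measurable_cube.
apply: (@le_trans _ _ (d.+1%:R%:E * \int[vol d]_z (K * (\1_(cube d 1) z)%:E))%E).
  rewrite lee_pmul2l// ?lte_fin ?ltr0n//; apply: ge0_le_integral => //.
  - by move=> z _; apply: integral_ge0.
  - apply: (@measurable_fun_fubini_tonelli_G _ _ _ _ _ mu (fun p => G (tcons p))) => //.
    by apply: (measurableT_comp mG); exact: measurable_tcons.
  - exact: measurable_funeM.
have C0 (z : d.-tuple R) : (0 <= (\1_(cube d 1) z)%:E :> \bar R)%E.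
  by rewrite lee_fin indicE.
rewrite ge0_integralZl//.
have -> : (\int[vol d]_z (\1_(cube d 1) z)%:E = (2 ^+ d)%:E :> \bar R)%E.
  rewrite integral_indic//; last exact: measurable_cube.
  rewrite setIT; apply: (etrans (lebesgue_tuple_cube d ler01)).
  by rewrite mulr1.
rewrite /K muleAC muleA -!EFinM.
rewrite (_ : d.+1%:R * (8 / (del ^+ 3 * N) * 2 ^+ d) =
    d.+1%:R * (8 / del ^+ 3) * 2 ^+ d / N)//.
by field; rewrite !gt_eqF.
Qed.

End far_sphere.

(** * Zonal kernels *)

Section zonal.
Context {R : realType}.
Implicit Types (psi : R -> R) (nu : R).
Local Notation mu := (@lebesgue_measure R).
Local Notation sigma := (surface_measure R).

(** For the kernel this is the inverse normalizing constant at h = 1 / nu, and for its square the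
    integral B. Multiplying by nu^2 instead of dividing by h^2 makes nu = 0 an ordinary point. *)
Definition zonal d psi nu (y : d.+1.-tuple R) : \bar R :=
  (\int[sigma d]_(x in sphere R d) (psi ((1 - dotp x y) * nu ^+ 2))%:E)%E.

Lemma sphere_dotp_le1 d (x y : d.+1.-tuple R) :
  sphere R d x -> sphere R d y -> dotp x y <= 1.
Proof.
move=> Sx Sy; have := dotp_ge0 (addt x (scalet (-1) y)).
rewrite dotpDr dotpZr 2!(dotpC (addt _ _)) !dotpDr !dotpZr (dotpC y x).
rewrite [dotp x x]Sx [dotp y y]Sy; lra.
Qed.

Lemma measurable_dotpr d (y : d.+1.-tuple R) : measurable_fun setT (fun x => dotp x y).
Proof. by apply: measurable_dotp; [exact: measurable_id|exact: measurable_cst]. Qed.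

Lemma measurable_profile_arg nu :
  measurable_fun setT (fun t : R => (1 - t) * nu ^+ 2).
Proof.
apply: measurable_funM; last exact: measurable_cst.
by apply: measurable_funB; [exact: measurable_cst|exact: measurable_id].
Qed.

Lemma measurable_zonal_integrand d psi nu (y : d.+1.-tuple R) :
  measurable_fun setT psi ->
  measurable_fun setT (fun x => (psi ((1 - dotp x y) * nu ^+ 2))%:E).
Proof.
move=> mpsi; apply/measurable_EFinP; apply: (measurableT_comp mpsi).
exact: (measurableT_comp (measurable_profile_arg nu) (measurable_dotpr y)).
Qed.

Lemma zonal_ge0 d psi nu (y : d.+1.-tuple R) :
  (forall s, 0 <= psi s) -> (0 <= zonal psi nu y)%E.
Proof. by move=> psi0; apply: integral_ge0 => x _; rewrite lee_fin. Qed.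

Lemma zonal_fin_num d psi nu (y : d.+1.-tuple R) (M : R) :
  measurable_fun setT psi -> (forall s, 0 <= psi s <= M) ->
  zonal psi nu y \is a fin_num.
Proof.
move=> mpsi psiM; have psi0 s : 0 <= psi s by case/andP: (psiM s).
have mS := @measurable_sphere R d.
rewrite ge0_fin_numE; last exact: zonal_ge0.
apply: (@le_lt_trans _ _ (\int[sigma d]_(x in sphere R d) (cst M%:E) x)%E).
  apply: ge0_le_integral => //.
  - by move=> x _; rewrite lee_fin.
  - exact: (measurable_funTS (measurable_zonal_integrand _ _ mpsi)).
  - by move=> x _; rewrite lee_fin; case/andP: (psiM ((1 - dotp x y) * nu ^+ 2)).
rewrite integral_cst//; apply: lte_mul_pinfty => //.
  by rewrite lee_fin (le_trans (psi0 0))//; case/andP: (psiM 0).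
by rewrite -ge0_fin_numE; [exact: fin_num_measure|exact: measure_ge0].
Qed.

Lemma zonal_const d psi nu (y z : d.+1.-tuple R) :
  measurable_fun setT psi -> (forall s, 0 <= psi s) ->
  sphere R d y -> sphere R d z -> zonal psi nu y = zonal psi nu z.
Proof.
move=> mpsi psi0 Sy Sz.
pose g (t : R) := (psi ((1 - t) * nu ^+ 2))%:E : \bar R.
have mg : measurable_fun setT g.
  apply/measurable_EFinP; apply: (measurableT_comp mpsi).
  exact: measurable_profile_arg.
have g0 t : (0 <= g t)%E by rewrite lee_fin.
by rewrite /zonal (ge0_integral_zonal Sy mg g0) (ge0_integral_zonal Sz mg g0).
Qed.

(** On the cap 1 - r^2 <= x.y the argument of [psi] is at most (r nu)^2 <= q^2. The radius is left
    free: r = q / nu yields the order nu^-d for large nu, and r = q / (nu + 1) yields positivity for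
    every nu >= 0. *)
Lemma zonal_ge d (y : d.+1.-tuple R) : sphere R d y ->
  exists2 c : R, 0 < c & forall psi (psi1 q nu r : R),
    measurable_fun setT psi -> (forall s, 0 <= psi s) -> 0 <= psi1 ->
    (forall s, 0 <= s <= q ^+ 2 -> psi1 <= psi s) ->
    0 <= nu -> 0 < r <= 1 -> r * nu <= q ->
    ((psi1 * (c * r ^+ d))%:E <= zonal psi nu y)%E.
Proof.
move=> Sy; have [c c0 cap] := cap_ge Sy; exists c => //.
move=> psi psi1 q nu r mpsi psi0 psi10 psiq nu0 r01 rq.
have mS := @measurable_sphere R d.
pose C : set (d.+1.-tuple R) := [set x | 1 - r ^+ 2 <= dotp x y].
have mC : measurable C.
  rewrite (_ : C = (fun x => dotp x y) @^-1` `[1 - r ^+ 2, +oo[); last first.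
    by apply/seteqP; split => x; rewrite /C /= in_itv/= andbT.
  by rewrite -[X in measurable X]setTI; exact: measurable_dotpr.
apply: (@le_trans _ _ (\int[sigma d]_(x in sphere R d) (psi1%:E * (\1_C x)%:E))%E).
  have mI : measurable_fun (sphere R d) (fun x => (\1_C x)%:E : \bar R).
    by apply: measurable_funTS; apply/measurable_EFinP; exact: measurable_indic.
  have I0 x : sphere R d x -> (0 <= (\1_C x)%:E :> \bar R)%E by rewrite lee_fin indicE.
  rewrite (ge0_integralZl_EFin _ _ _ _ psi10)// integral_indic// setIC.
  by rewrite EFinM lee_wpmul2l ?lee_fin//; exact: cap.
apply: ge0_le_integral => //.
- by move=> x _; rewrite mule_ge0 ?lee_fin ?indicE.
- apply: measurable_funeM; apply: measurable_funTS; apply/measurable_EFinP.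
  exact: measurable_indic.
- exact: (measurable_funTS (measurable_zonal_integrand _ _ mpsi)).
move=> x Sx; rewrite -EFinM lee_fin indicE; have [xC|xC] := boolP (x \in C).
  rewrite mulr1; apply: psiq; move: xC; rewrite inE /C /= => xC.
  rewrite mulr_ge0 ?sqr_ge0 ?subr_ge0 ?sphere_dotp_le1//=.
  case/andP: r01 => r0 r1.
  apply: (@le_trans _ _ ((r * nu) ^+ 2)); last first.
    by rewrite lerXn2r ?nnegrE ?mulr_ge0 ?(ltW r0)// (le_trans _ rq)// mulr_ge0 ?(ltW r0).
  by rewrite exprMn ler_wpM2r ?sqr_ge0//; lra.
by rewrite mulr0.
Qed.

End zonal.

(** * Concentration of zonal kernels *)

Section concentration.
Context {R : realType}.
Implicit Types (phi : R -> R) (nu : R).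
Local Notation mu := (@lebesgue_measure R).
Local Notation sigma := (surface_measure R).

(** The Cauchy-Schwarz estimate on the caps is kept in additive form with a free parameter [c], so
    that no square roots appear; [concentration] chooses [c] proportional to the left-hand side
    itself. *)
Lemma zonal_le_split d phi nu (y : d.+1.-tuple R) (del c : R) :
  measurable_fun setT phi -> (forall s, 0 <= phi s) -> 0 < c ->
  (zonal phi nu y <=
    (c / 2)%:E * sigma d (sphere R d `&` [set x | 1 - del < `|dotp x y|]%R) +
    ((2 * c)^-1)%:E * zonal (fun s => phi s ^+ 2)%R nu y +
    \int[sigma d]_(x in sphere R d)
      (phi ((1 - dotp x y) * nu ^+ 2) *
        \1_[set` `[(- (1 - del))%R, (1 - del)%R]] (dotp x y))%:E)%E.
Proof.
move=> mphi phi0 c0.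
have mS := @measurable_sphere R d.
pose J : set R := [set` `[- (1 - del), 1 - del]].
have mJ : measurable J by exact: measurable_itv.
pose near : set (d.+1.-tuple R) := [set x | 1 - del < `|dotp x y|].
have JE t : (t \in J) = (`|t| <= 1 - del).
  by apply/idP/idP; rewrite inE /J /= in_itv/= -ler_norml.
have nearE x : (x \in near) = ~~ (dotp x y \in J).
  by rewrite JE -ltNge; apply/idP/idP; rewrite inE.
have mnear : measurable near.
  rewrite (_ : near = (fun x => dotp x y) @^-1` (~` J)); last first.
    apply/seteqP; split=> x.
      by rewrite /near /= => h Jx; have := mem_set Jx; rewrite JE leNgt h.
    by move=> nJ; rewrite /near /= ltNge -JE; apply/negP => /set_mem.
  rewrite -[X in measurable X]setTI; apply: measurable_dotpr => //.
  exact: measurableC.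
pose e1 x : \bar R := ((c / 2)%:E * (\1_near x)%:E)%E.
pose p x := phi ((1 - dotp x y) * nu ^+ 2).
pose e2 x : \bar R := (((2 * c)^-1)%:E * (p x ^+ 2)%:E)%E.
pose e3 x : \bar R := (p x * \1_J (dotp x y))%:E.
have mp : measurable_fun setT p.
  apply: (measurableT_comp mphi).
  exact: (measurableT_comp (measurable_profile_arg nu) (measurable_dotpr y)).
have mI : measurable_fun (sphere R d) (fun x => (\1_near x)%:E : \bar R).
  by apply: measurable_funTS; apply/measurable_EFinP; exact: measurable_indic.
have mp2 : measurable_fun (sphere R d) (fun x => (p x ^+ 2)%:E).
  apply: measurable_funTS; apply/measurable_EFinP.
  by apply: measurable_funX.
have m1 : measurable_fun (sphere R d) e1 by exact: measurable_funeM.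
have m2 : measurable_fun (sphere R d) e2 by exact: measurable_funeM.
have m3 : measurable_fun (sphere R d) e3.
  apply: measurable_funTS; apply/measurable_EFinP; apply: measurable_funM => //.
  have mJ1 : measurable_fun setT (\1_J : R -> R) by exact: measurable_indic.
  exact: (measurableT_comp mJ1 (measurable_dotpr y)).
have c20 : 0 <= c / 2 by lra.
have c21 : 0 <= (2 * c)^-1 by rewrite invr_ge0; lra.
have I0 x : (0 <= (\1_near x)%:E :> \bar R)%E by rewrite lee_fin indicE.
have p20 x : (0 <= (p x ^+ 2)%:E)%E by rewrite lee_fin sqr_ge0.
have e10 x : (0 <= e1 x)%E by rewrite mule_ge0// lee_fin.
have e20 x : (0 <= e2 x)%E by rewrite mule_ge0// lee_fin.
have e30 x : (0 <= e3 x)%E by rewrite lee_fin mulr_ge0 ?phi0// indicE.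
pose e12 x := (e1 x + e2 x)%E.
have e120 x : (0 <= e12 x)%E by rewrite adde_ge0.
have -> : ((c / 2)%:E * sigma d (sphere R d `&` near) = \int[sigma d]_(x in sphere R d) e1 x)%E.
  by rewrite (ge0_integralZl_EFin _ _ _ _ c20)// integral_indic// setIC.
have -> : (((2 * c)^-1)%:E * zonal (fun s => phi s ^+ 2)%R nu y = \int[sigma d]_(x in sphere R d) e2 x)%E.
  by rewrite (ge0_integralZl_EFin _ _ _ _ c21).
have m12 : measurable_fun (sphere R d) e12 by exact: emeasurable_funD.
rewrite -ge0_integralD// -(@ge0_integralD _ _ _ _ _ mS e12)//.
apply: ge0_le_integral => //.
- by move=> x _; rewrite lee_fin phi0.
- by apply: measurable_funTS; exact/measurable_EFinP.
- by apply: emeasurable_funD => //; exact: emeasurable_funD.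
move=> x _; rewrite -/(p x) /e12 /e1 /e2 /e3 !indicE nearE -/J -!EFinM -!EFinD lee_fin.
have pq : 0 <= (2 * c)^-1 * p x ^+ 2 by rewrite mulr_ge0 ?sqr_ge0.
case: (_ \in J) => /=; first by lra.
(* AM-GM: p <= c / 2 + p^2 / (2 c) *)
rewrite mulr0 addr0 mulr1 -subr_ge0.
rewrite (_ : _ - _ = (2 * c)^-1 * (p x - c) ^+ 2); last by field; rewrite gt_eqF.
by rewrite mulr_ge0 ?sqr_ge0.
by move=> x _; exact: e30.
Qed.

Lemma continuous_half_near0 phi : continuous phi -> 0 < phi 0 ->
  exists q : R, [/\ 0 < q, q <= 1 &
    forall s, 0 <= s <= q ^+ 2 -> phi 0 / 2 <= phi s].
Proof.
move=> cphi phi00.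
have : \forall s \near (0 : R), phi 0 / 2 <= phi s.
  have h : phi 0 / 2 < phi 0 by lra.
  exact: (@cvgr_ge _ _ _ _ phi (phi 0) (cphi 0) _ h).
move=> /nbhs_normP[e /= e0 He].
exists (Num.min 1 (e / 2)); split; [|by rewrite ge_min lexx|].
  by rewrite lt_min ltr01/=; lra.
move=> s /andP[s0 sq]; apply: He => /=; rewrite sub0r normrN ger0_norm//.
set t := Num.min _ _ in sq.
have t0 : 0 <= t by rewrite le_min ler01/=; lra.
have t1 : t <= 1 by rewrite ge_min lexx.
have te : t <= e / 2 by rewrite ge_min lexx orbT.
have : t ^+ 2 <= t by rewrite expr2 ler_piMr.
lra.
Qed.

(** By contradiction, let b < K a^2 with a and b the integrals of [phi] and its square. Splitting
    with parameter 2 K a makes the area term and the quadratic term at most a / 4 each, so a <= 2 F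
    with F bounding the middle part. Then b < 4 K F^2, which is incompatible with b >= c1 nu^-d for
    large nu. *)
Lemma concentration d (y : d.+1.-tuple R) phi (M Q : R) :
  (1 <= d)%N -> sphere R d y -> continuous phi ->
  (forall s, 0 <= phi s <= M) -> 0 < phi 0 ->
  (forall a : R, 0 < a -> exists T : R, [/\ 0 <= T,
     (\int[mu]_(s in `[a, +oo[) (phi s)%:E <= T%:E)%E & T ^+ 2 * a ^+ (d - 2) <= Q]) ->
  forall K : R, 0 < K -> exists nu0 : R, forall nu, nu0 <= nu ->
    K * fine (zonal phi nu y) ^+ 2 <= fine (zonal (fun s => phi s ^+ 2) nu y).
Proof.
move=> d1 Sy cphi phiM phi00 tail K K0.
have phi0 s : 0 <= phi s by case/andP: (phiM s).
have mphi : measurable_fun setT phi by exact: continuous_measurable_fun.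
pose psi s := phi s ^+ 2.
have mpsi : measurable_fun setT psi by exact: measurable_funX.
have psi0 s : 0 <= psi s by exact: sqr_ge0.
have M0 : 0 <= M by rewrite (le_trans (phi0 0))//; case/andP: (phiM 0).
have psiM s : 0 <= psi s <= M ^+ 2.
  by rewrite psi0 lerXn2r ?nnegrE//; case/andP: (phiM s).
(* A cap area of (4 K)^-1 turns the area term into a / 4 when the splitting parameter is 2 K a. *)
have m0 : 0 < (4 * K)^-1 by rewrite invr_gt0 mulr_gt0.
have [del /andP[del0 del1] caps] := caps_cvg0 d1 Sy m0.
have [c c0 zge] := zonal_ge Sy.
have [q [q0 q1 phiq]] := continuous_half_near0 cphi phi00.
pose C : R := d.+1%:R * (8 / del ^+ 3) * 2 ^+ d.
have C0 : 0 < C by rewrite !mulr_gt0 ?invr_gt0 ?exprn_gt0 ?ltr0n.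
pose c1 := (phi 0 / 2) ^+ 2 * (c * q ^+ d).
have c10 : 0 < c1 by rewrite !mulr_gt0 ?exprn_gt0//; lra.
pose Q' := Q * (4 / del ^+ 2) ^+ (d - 2).
(* The bound nu >= 1 makes q / nu an admissible radius and powers of nu monotone in the exponent;
   the other bound says 4 K C^2 Q' <= c1 nu. *)
exists (Num.max 1 (4 * K * C ^+ 2 * Q' / c1)) => nu.
rewrite ge_max => /andP[nu1 nuQ].
have nu0 : 0 < nu by lra.
set a := fine _; set b := fine _.
have aE : zonal phi nu y = a%:E by rewrite fineK// (zonal_fin_num _ _ mphi phiM).
have bE : zonal psi nu y = b%:E by rewrite fineK// (zonal_fin_num _ _ mpsi psiM).
have a0 : 0 <= a by rewrite -lee_fin -aE zonal_ge0.
have b_ge : c1 <= b * nu ^+ d.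
  have := zge psi ((phi 0 / 2) ^+ 2) q nu (q / nu) mpsi psi0 (sqr_ge0 _).
  rewrite bE lee_fin (expr_div_n q) => h; rewrite -ler_pdivrMr ?exprn_gt0//.
  rewrite (_ : c1 / _ = (phi 0 / 2) ^+ 2 * (c * (q ^+ d / nu ^+ d))); last first.
    by rewrite /c1 -mulrA -(mulrA c).
  apply: h.
  - by move=> s sq; rewrite lerXn2r ?nnegrE ?divr_ge0// phiq.
  - exact: ltW.
  - by rewrite divr_gt0//= ler_pdivrMr// mul1r (le_trans q1).
  - by rewrite divfK// gt_eqF.
have aa0 : 0 < del ^+ 2 * nu ^+ 2 / 4 by rewrite divr_gt0// mulr_gt0 ?exprn_gt0.
have [T [T0 IT TQ]] := tail _ aa0.
pose F := C / nu ^+ 2 * T.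
have {}TQ : T ^+ 2 * (nu ^+ 2) ^+ (d - 2) <= Q'.
  rewrite /Q' -ler_pdivrMr ?exprn_gt0 ?divr_gt0 ?exprn_gt0//.
  rewrite -mulrA -expr_div_n (_ : nu ^+ 2 / _ = del ^+ 2 * nu ^+ 2 / 4)//.
  by field; rewrite gt_eqF.
have a_le e : 0 < e -> a <= e / 2 * (4 * K)^-1 + (2 * e)^-1 * b + F.
  move=> e0; rewrite -lee_fin -aE.
  apply: (le_trans (zonal_le_split nu y del mphi phi0 e0)).
  rewrite bE !EFinD !EFinM; apply: leeD; first apply: leeD => //.
    by rewrite lee_wpmul2l// lee_fin; lra.
  have N0 : 0 < nu ^+ 2 by rewrite exprn_gt0.
  have d01 : 0 < del <= 1 by rewrite del0 ltW.
  apply: (le_trans (integral_middle_le Sy cphi phi0 N0 d01)).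
  by rewrite /F EFinM lee_wpmul2l// lee_fin divr_ge0// ltW.
rewrite leNgt; apply/negP => ba.
have {}a0 : 0 < a.
  rewrite lt_neqAle a0 andbT; apply/negP => /eqP a00.
  move: ba; rewrite -a00 expr0n mulr0 ltNge -lee_fin -bE zonal_ge0//.
have F0 : 0 <= F by rewrite mulr_ge0// divr_ge0 ?exprn_ge0// ?(ltW C0) ?(ltW nu0).
have aF : a <= 2 * F.
  have e0 : 0 < 2 * K * a by rewrite !mulr_gt0.
  have := a_le _ e0.
  have -> : 2 * K * a / 2 * (4 * K)^-1 = a / 4 by field; rewrite gt_eqF.
  have : (2 * (2 * K * a))^-1 * b <= a / 4.
    rewrite mulrC ler_pdivrMr ?mulr_gt0//.
    by rewrite (_ : a / 4 * _ = K * a ^+ 2) 1?ltW//; field.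
  lra.
have : b < 4 * K * F ^+ 2.
  apply: (lt_le_trans ba); rewrite (_ : 4 * K * F ^+ 2 = K * (2 * F) ^+ 2); last by ring.
  rewrite ler_pM2l//; have : 0 <= 2 * F by rewrite mulr_ge0.
  by move=> F20; rewrite lerXn2r// nnegrE ltW.
apply/negP; rewrite -leNgt.
pose P := (nu ^+ 2) ^+ (d - 2).
have P0 : 0 < P by rewrite !exprn_gt0.
have b0 : 0 <= b by rewrite -lee_fin -bE zonal_ge0.
(* The exponent is 4 for d <= 2 and 2 d beyond, since the subtraction is truncated; in all cases a
   power of nu is left over, which absorbs the constants. *)
have dexp : (d.+1 <= 4 + 2 * (d - 2))%N by clear -d1; lia.
have h1 : 4 * K * C ^+ 2 * Q' <= c1 * nu by rewrite -ler_pdivrMl// mulrC.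
have h2 : nu ^+ d * nu <= nu ^+ 4 * P.
  rewrite /P -exprM -exprD -exprSr ler_weXn2l//.
rewrite /F (_ : 4 * K * (C / nu ^+ 2 * T) ^+ 2 = 4 * K * C ^+ 2 * T ^+ 2 / nu ^+ 4); last first.
  by field; rewrite gt_eqF.
rewrite ler_pdivrMr ?exprn_gt0// -(ler_pM2r P0).
apply: (@le_trans _ _ (c1 * nu)).
  apply: le_trans h1; rewrite -(mulrA _ (T ^+ 2)) ler_wpM2l//.
  by apply: mulr_ge0; [apply: mulr_ge0 => //; exact: ltW|exact: sqr_ge0].
apply: (@le_trans _ _ (b * nu ^+ d * nu)); first by rewrite ler_pM2r.
by rewrite -(mulrA b (nu ^+ d)) -(mulrA b (nu ^+ 4)) ler_wpM2l.
Qed.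

End concentration.

(** * Continuity, positivity and tails *)

Section kernel.
Context {R : realType}.
Implicit Types (phi L : R -> R) (nu : R).
Local Notation mu := (@lebesgue_measure R).
Local Notation sigma := (surface_measure R).

Lemma continuous_max0 L : {within `[0, +oo[, continuous L} ->
  continuous (fun s : R => L (Num.max s 0)).
Proof.
move=> /subspace_continuousP cL x; rewrite /continuous_at.
have Ax : [set` `[0, +oo[] (Num.max x 0) by rewrite /= in_itv/= andbT le_max lexx orbT.
apply: cvg_trans (cL _ Ax) => A.
rewrite !nbhs_simpl /=.
move=> wA.
have : \forall t \near x, [set` `[0, +oo[] (Num.max t 0) -> A (L (Num.max t 0)).
  have cm : continuous (fun t : R => Num.max t 0).
    by move=> t; apply: continuous_max => //; exact: cst_continuous.
  exact: (cm x _ wA).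
apply: filterS => t; apply.
by rewrite /= in_itv/= andbT le_max lexx orbT.
Qed.

Lemma zonal_cvg d phi (M : R) (y : d.+1.-tuple R) (u : R^nat) (l : R) :
  continuous phi -> (forall s, 0 <= phi s <= M) -> u @ \oo --> l ->
  fine (zonal phi (u n) y) @[n --> \oo] --> fine (zonal phi l y).
Proof.
move=> cphi phiM ul.
have mphi : measurable_fun setT phi by exact: continuous_measurable_fun.
have fin nu := zonal_fin_num nu y mphi phiM.
have mS := @measurable_sphere R d.
apply: fine_cvg; rewrite fineK//.
apply: (@dominated_cvg _ _ _ _ _ mS _ _ (EFin \o cst M)).
- by move=> n; apply: (measurable_funTS (measurable_zonal_integrand _ _ mphi)).
- move=> x _; apply: cvg_EFin; first exact: nearW.
  change (phi ((1 - dotp x y) * u n ^+ 2) @[n --> \oo] --> phi ((1 - dotp x y) * l ^+ 2)).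
  have h : continuous (fun t : R => phi ((1 - dotp x y) * t ^+ 2)).
    move=> t; apply: (@continuous_comp _ _ _ (fun t : R => (1 - dotp x y) * t ^+ 2) phi); last exact: cphi.
    by apply: cvgM; [exact: cvg_cst|exact: exprn_continuous].
  exact: (cvg_comp _ _ ul (h l)).
- by [].
- exact: (finite_measure_integrable_cst _ M mS).
- move=> n x _ /=; rewrite lee_fin ger0_norm; by case/andP: (phiM ((1 - dotp x y) * u n ^+ 2)).
Qed.

Lemma zonal_gt0 d phi (M : R) (y : d.+1.-tuple R) nu :
  continuous phi -> (forall s, 0 <= phi s <= M) -> 0 < phi 0 ->
  sphere R d y -> 0 <= nu -> 0 < fine (zonal phi nu y).
Proof.
move=> cphi phiM phi00 Sy nu0.
have mphi : measurable_fun setT phi by exact: continuous_measurable_fun.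
have phi0 s : 0 <= phi s by case/andP: (phiM s).
have [q [q0 q1 phiq]] := continuous_half_near0 cphi phi00.
have [c c0 zge] := zonal_ge Sy.
have nu10 : 0 < nu + 1 by lra.
have r0 : 0 < q / (nu + 1) by rewrite divr_gt0.
rewrite -lte_fin fineK ?(zonal_fin_num _ _ mphi phiM)//.
apply: (@lt_le_trans _ _ (phi 0 / 2 * (c * (q / (nu + 1)) ^+ d))%:E).
  by rewrite lte_fin !mulr_gt0 ?exprn_gt0.
apply: (zge _ _ q) => //.
- by rewrite divr_ge0// ltW.
- by rewrite r0 ler_pdivrMr// mul1r; lra.
- by rewrite mulrAC ler_pdivrMr// ler_pM2l//; lra.
Qed.

(** T is the integral of [L] over [a, +oo[. For d <= 2 the power of a is 1 and T <= I1. For d > 2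
    the exponent p = d / 2 - 1 is positive, so s^p >= a^p on the tail gives T a^p <= I2, whose
    square is the claim. *)
Lemma kernel_tail d L : measurable_fun (`[0, +oo[%classic : set (measurableTypeR R)) L ->
  (forall s : R, 0 <= s -> 0 <= L s) -> mu.-integrable `[0, +oo[ (EFin \o L) ->
  (0 < lambda d (fun s => (L s ^+ 1)%R) < +oo)%E ->
  exists Q : R, forall a : R, 0 < a -> exists T : R, [/\ 0 <= T,
    (\int[mu]_(s in `[a, +oo[) (L (Num.max s 0))%:E <= T%:E)%E &
    T ^+ 2 * a ^+ (d - 2) <= Q].
Proof.
move=> mL L0 L_int /andP[lam0 lamoo].
pose p : R := d%:R / 2 - 1.
pose A (a : R) : set (measurableTypeR R) := [set` `[a, +oo[].
have mA a : measurable (A a) by exact: measurable_itv.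
have I1fin : (\int[mu]_(s in A 0%R) (L s)%:E \is a fin_num)%E.
  have := integrable_fin_num (mA 0) L_int; exact.
set I1 := (\int[mu]_(s in A 0%R) (L s)%:E)%E in I1fin.
pose I2 := (\int[mu]_(s in A 0%R) (L s * s `^ p)%:E)%E.
have mLp : measurable_fun (A 0) (fun s => (L s * s `^ p)%:E).
  apply/measurable_EFinP; apply: measurable_funM => //.
  by apply: measurable_funTS; exact: measurable_powR.
have Lp0 s : A 0 s -> (0 <= (L s * s `^ p)%:E)%E.
  by rewrite /A /= in_itv/= andbT => s0; rewrite lee_fin mulr_ge0 ?L0 ?powR_ge0.
have I20 : (0 <= I2)%E by apply: integral_ge0.
have I2fin : I2 \is a fin_num.
  move: lam0 lamoo; rewrite /lambda -/p -/I2.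
  set k := _ * omega _ _.
  rewrite ge0_fin_numE//; case: I2 I20 => [r| |] // _; first by move=> _ _; exact: ltry.
  (* An infinite integral would make [lambda] equal to +oo, -oo or 0 according to the sign of k,
     each excluded by 0 < lambda < +oo. *)
  have [k0|k0|<-] := ltgtP 0 k.
  - by rewrite gt0_muley// lte_fin.
  - by rewrite lt0_muley// lte_fin.
  - by rewrite mul0e ltxx.
exists (fine I1 ^+ 2 + fine I2 ^+ 2) => a a0.
have A0a : A a `<=` A 0.
  by move=> s; rewrite /A /= !in_itv/= !andbT; exact/le_trans/ltW.
have TE : (\int[mu]_(s in A a) (L (Num.max s 0))%:E = \int[mu]_(s in A a) (L s)%:E)%E.
  apply: eq_integral => s /set_mem/A0a; rewrite /A /= in_itv/= andbT => s0.
  by rewrite (max_idPl s0).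
have LA s : A 0 s -> (0 <= (L s)%:E)%E.
  by rewrite /A /= in_itv/= andbT lee_fin; exact: L0.
have mLE : measurable_fun (A 0) (fun s => (L s)%:E) by exact/measurable_EFinP.
pose T := (\int[mu]_(s in A a) (L s)%:E)%E.
have T0 : (0 <= T)%E by apply: integral_ge0 => s /A0a; exact: LA.
have TI1 : (T <= I1)%E by exact: ge0_subset_integral.
have Tfin : T \is a fin_num.
  by rewrite ge0_fin_numE// (le_lt_trans TI1)// -ge0_fin_numE// (le_trans T0).
exists (fine T); split; first exact: fine_ge0.
  by rewrite TE fineK.
have TI1r : fine T <= fine I1 by rewrite fine_le.
have fT0 : 0 <= fine T by exact: fine_ge0.
have sq1 : fine T ^+ 2 <= fine I1 ^+ 2 by rewrite lerXn2r// nnegrE// (le_trans fT0).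
have [d2|d2] := leqP d 2.
  have -> : (d - 2 = 0)%N by apply/eqP; rewrite subn_eq0.
  by rewrite expr0 mulr1 (le_trans sq1)// lerDl sqr_ge0.
have p0 : 0 <= p by rewrite /p subr_ge0 ler_pdivlMr// mul1r ler_nat ltnW.
have TI2 : (T * (a `^ p)%:E <= I2)%E.
  apply: (@le_trans _ _ (\int[mu]_(s in A a) (L s * s `^ p)%:E)%E); last first.
    by apply: ge0_subset_integral.
  rewrite muleC -(ge0_integralZl_EFin _ _ _ _ (powR_ge0 _ _))//; first last.
  - exact: measurable_funS mLE.
  - by move=> s /A0a; exact: LA.
  apply: ge0_le_integral => //.
  - by move=> s /A0a/LA Ls; rewrite mule_ge0// lee_fin powR_ge0.
  - by apply: measurable_funeM; exact: measurable_funS mLE.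
  - exact: measurable_funS mLp.
  move=> s As; rewrite -EFinM lee_fin mulrC ler_wpM2l//.
    by have := LA _ (A0a _ As).
  move: As; rewrite /A /= in_itv/= andbT => As.
  by rewrite ge0_ler_powR// nnegrE ?(ltW a0)// (le_trans (ltW a0)).
have sq2 : (fine T * a `^ p) ^+ 2 <= fine I2 ^+ 2.
  have : fine T * a `^ p <= fine I2 by rewrite -lee_fin EFinM !fineK.
  by move=> h; rewrite lerXn2r// nnegrE ?mulr_ge0 ?powR_ge0// fine_ge0.
have <- : (a `^ p) ^+ 2 = a ^+ (d - 2).
  rewrite -!powR_mulrn ?powR_ge0 ?(ltW a0)// -powRrM; congr (_ `^ _).
  by rewrite /p natrB ?(ltnW d2)//; field.
by rewrite -exprMn (le_trans sq2)// lerDr sqr_ge0.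
Qed.

End kernel.

(** * Minimization *)

Section minimum.
Context {R : realType}.

Lemma limn_einf_le_cvg (v w : (\bar R)^nat) (l : \bar R) :
  (forall k, v k <= w k)%E -> w @ \oo --> l -> (limn_einf v <= l)%E.
Proof.
move=> vw wl; rewrite limn_einf_lim -(cvg_lim _ wl)//.
apply: lee_lim; [exact: is_cvg_einfs|by apply/cvg_ex; exists l|].
by apply: nearW => k; apply: le_trans (vw k); apply: ereal_inf_lbound; exists k => /=.
Qed.

Lemma sequentially_lsc_coercive_min (E : R -> \bar R) :
  (forall nu, 0 <= nu -> (0 <= E nu)%E) ->
  (forall (u : R^nat) (l : R), (forall k, 0 <= u k) -> u @ \oo --> l ->
    (E l <= limn_einf (E \o u))%E) ->
  (forall K : R, exists nu0, forall nu, nu0 <= nu -> (K%:E <= E nu)%E) ->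
  exists nu : R, 0 <= nu /\ forall t, 0 <= t -> (E nu <= E t)%E.
Proof.
move=> E0 Elsc Ecoer.
pose m := ereal_inf (E @` [set t | 0 <= t]).
have m0 : (0 <= m)%E by apply: le_ereal_inf_tmp => _ [t t0 <-]; exact: E0.
have mE t : 0 <= t -> (m <= E t)%E by move=> t0; apply: ereal_inf_lbound; exists t.
have [moo|] := eqVneq m +oo%E.
  exists 0; split=> // t t0; have := mE t t0; rewrite moo leye_eq => /eqP ->.
  exact: leey.
move=> mNoo; have mfin : m \is a fin_num by rewrite ge0_fin_numE// ltey.
have /choice[u uP] : forall k : nat, exists t : R,
    0 <= t /\ (E t < m + (k.+1%:R^-1)%:E)%E.
  move=> k; have k0 : 0 < k.+1%:R^-1 :> R by rewrite invr_gt0.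
  by have [_ [t t0 <-] Et] := lb_ereal_inf_adherent k0 mfin; exists t.
(* The values along the minimizing sequence are below m + 1 / (k + 1) <= m + 1, so coercivity at
   this level bounds the sequence. *)
have [nu0 nu0P] := Ecoer (fine m + 1).
have ub k : u k <= Num.max nu0 0.
  rewrite le_max; case: (leP nu0 (u k)) => [/nu0P h|/ltW ->//].
  have [_ /(le_lt_trans h)] := uP k.
  rewrite -{2}(fineK mfin) -EFinD lte_fin ltrD2l ltNge invf_le1// ler1n//.
have bu : bounded_fun u.
  exists (Num.max nu0 0); split; first exact: num_real.
  move=> x xB k _ /=; rewrite ger0_norm; last by have [] := uP k.
  by rewrite (le_trans (ub k))// ltW.
have [f finc /cvg_ex[/= l ul]] := bolzano_weierstrass bu.
have l0 : 0 <= l.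
  rewrite -(cvg_lim _ ul)//; apply: limr_ge; first by apply/cvg_ex; exists l.
  by apply: nearW => k /=; have [] := uP (f k).
exists l; split=> // t t0; apply: le_trans (mE t t0).
have fk k : (k <= f k)%N.
  elim: k => // k IH; apply: (leq_ltn_trans IH).
  by have := finc k.+1 k; rewrite !leEnat ltnn ltnNge => ->.
apply: le_trans (Elsc (u \o f) l _ ul) _ => [k|]; first by have [] := uP (f k).
apply: (@limn_einf_le_cvg _ (fun k => m + k.+1%:R^-1%:E)%E) => [k|].
  have [_ /ltW h] := uP (f k); apply: (le_trans h).
  rewrite leeD2l// lee_fin lef_pV2 ?posrE ?ltr0n// ler_nat ltnS//.
rewrite -[X in _ --> X]adde0; apply: cvgeD; [by rewrite fin_num_adde_defr|exact: cvg_cst|exact: cvge_harmonic].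
Qed.

End minimum.

(** * The mean integrated squared error *)

Lemma cvgn_sum (R : realType) (n : nat) (u : 'I_n -> R^nat) (l : 'I_n -> R) :
  (forall i, u i @ \oo --> l i) ->
  \sum_(i < n) u i k @[k --> \oo] --> \sum_(i < n) l i.
Proof.
elim: n u l => [|n IH] u l ul.
  rewrite big_ord0 (_ : (fun k => _) = cst 0); first exact: cvg_cst.
  by apply/funext => k; rewrite big_ord0.
rewrite big_ord_recr /= (_ : (fun k => _) = (fun k =>
  \sum_(i < n) u (widen_ord (leqnSn n) i) k) \+ u ord_max); last first.
  by apply/funext => k; rewrite big_ord_recr.
by apply: cvgD; [exact: IH|exact: ul].
Qed.

Section mean_integrated_error.
Context (R : realType) (d n : nat) (f : d.+1.-tuple R -> R) (phi : R -> R) (M : R)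
  (dO : measure_display) (Omega : measurableType dO) (P : probability Omega R)
  (X : 'I_n -> Omega -> d.+1.-tuple R).
Local Notation sigma := (surface_measure R).
Local Notation mS := (@measurable_sphere R d).

Hypotheses (n0 : (0 < n)%N) (mf : measurable_fun (sphere R d) f)
  (cphi : continuous phi) (phiM : forall s, 0 <= phi s <= M) (phi00 : 0 < phi 0)
  (mX : forall i, measurable_fun setT (X i)) (SX : forall i w, sphere R d (X i w)).

Let mphi : measurable_fun setT phi.
Proof. exact: continuous_measurable_fun. Qed.

Let phi0 s : 0 <= phi s.
Proof. by case/andP: (phiM s). Qed.

Definition pole : d.+1.-tuple R := tcons (1, [tuple of nseq d 0]).

Lemma sphere_pole : sphere R d pole.
Proof.
rewrite /sphere /= /pole dotp_tcons mulr1 /dotp big1 ?addr0// => i _.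
by rewrite !tnth_nseq mulr0.
Qed.

(** Taken at a fixed pole: by rotation invariance the value is the same at every sample point, and
    the normalization becomes deterministic. *)
Definition mass nu : R := fine (zonal phi nu pole).

Lemma mass_gt0 nu : 0 <= nu -> 0 < mass nu.
Proof. exact: (zonal_gt0 cphi phiM phi00 sphere_pole). Qed.

Definition estimator nu (w : Omega) (x : d.+1.-tuple R) : R :=
  n%:R^-1 * \sum_(i < n) (mass nu)^-1 * phi ((1 - dotp x (X i w)) * nu ^+ 2).

(* The restriction to the sphere is part of the integrand so that Fatou's lemma
   applies on the product space. *)
Definition sq_error nu (z : Omega * d.+1.-tuple R) : \bar R :=
  ((estimator nu z.1 z.2 - (f \_ (sphere R d)) z.2) ^+ 2 * \1_(sphere R d) z.2)%:E.

Definition mean_error nu : \bar R :=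
  (\int[P]_w \int[sigma d]_x sq_error nu (w, x))%E.

Lemma sq_error_ge0 nu z : (0 <= sq_error nu z)%E.
Proof. by rewrite lee_fin mulr_ge0 ?sqr_ge0// indicE. Qed.

Lemma measurable_sq_error nu : measurable_fun setT (sq_error nu).
Proof.
have m1 : measurable_fun setT (fst : Omega * d.+1.-tuple R -> Omega).
  exact: measurable_fst.
have m2 : measurable_fun setT (snd : Omega * d.+1.-tuple R -> d.+1.-tuple R).
  exact: measurable_snd.
apply/measurable_EFinP; apply: measurable_funM; last first.
  have mI : measurable_fun setT (\1_(sphere R d) : d.+1.-tuple R -> R).
    by apply: measurable_indic; exact: mS.
  exact: (measurableT_comp mI m2).
apply: measurable_funX; apply: measurable_funB; last first.
  exact: (measurableT_comp ((measurable_restrictT _ mS).1 mf) m2).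
apply: measurable_funM; first exact: measurable_cst.
apply: measurable_sum => i; apply: measurable_funM; first exact: measurable_cst.
apply: (measurableT_comp mphi); apply: measurable_funM; last exact: measurable_cst.
apply: measurable_funB; first exact: measurable_cst.
by apply: measurable_dotp => //; exact: (measurableT_comp (mX i) m1).
Qed.

Lemma cvg_estimator (u : R^nat) (l : R) w x : 0 <= l -> u @ \oo --> l ->
  estimator (u k) w x @[k --> \oo] --> estimator l w x.
Proof.
move=> l0 ul; apply: cvgM; first exact: cvg_cst.
apply: cvgn_sum => i; apply: cvgM.
  apply: cvgV; first by rewrite gt_eqF// mass_gt0.
  exact: (zonal_cvg cphi phiM ul).
have h : continuous (fun t : R => phi ((1 - dotp x (X i w)) * t ^+ 2)).
  move=> t; apply: (@continuous_comp _ _ _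
    (fun t : R => (1 - dotp x (X i w)) * t ^+ 2) phi); last exact: cphi.
  by apply: cvgM; [exact: cvg_cst|exact: exprn_continuous].
exact: (cvg_comp _ _ ul (h l)).
Qed.

Lemma mean_error_lsc (u : R^nat) (l : R) : (forall k, 0 <= u k) -> u @ \oo --> l ->
  (mean_error l <= limn_einf (mean_error \o u))%E.
Proof.
move=> u0 ul.
have l0 : 0 <= l.
  rewrite -(cvg_lim _ ul)//; apply: limr_ge; first by apply/cvg_ex; exists l.
  exact: nearW.
have E nu : mean_error nu = (\int[P \x sigma d]_z sq_error nu z)%E.
  by rewrite fubini_tonelli1//; [exact: measurable_sq_error|exact: sq_error_ge0].
rewrite E (_ : mean_error \o u =
  (fun k => \int[P \x sigma d]_z sq_error (u k) z)%E); last first.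
  by apply/funext => k /=; exact: E.
apply: le_trans (fatou _ measurableT (fun k => measurable_sq_error (u k))
  (fun k z _ => sq_error_ge0 (u k) z)).
rewrite le_eqVlt; apply/orP; left; apply/eqP; apply: eq_integral => -[w x] _.
have c : sq_error (u k) (w, x) @[k --> \oo] --> sq_error l (w, x).
  apply: cvg_EFin; first exact: nearW.
  apply: cvgM; last exact: cvg_cst.
  rewrite /= expr2.
  have c1 : estimator (u k) w x - (f \_ (sphere R d)) x @[k --> \oo] -->
      estimator l w x - (f \_ (sphere R d)) x.
    by apply: cvgB; [exact: cvg_estimator|exact: cvg_cst].
  exact: cvgM.
by have [-> _] := cvg_limn_einf_sup c.
Qed.

(** The bound holds for each outcome w separately. All terms of the estimator are nonnegative, so it
    dominates the term t of a single sample point; then (k - f)^2 + f^2 >= k^2 / 2 >= t^2 / 2, and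
    t^2 integrates to b / (n a)^2 over the sphere. *)
Lemma mean_error_coercive :
  square_integrable f ->
  (forall K : R, 0 < K -> exists nu0 : R, forall nu, nu0 <= nu ->
     K * mass nu ^+ 2 <= fine (zonal (fun s => phi s ^+ 2) nu pole)) ->
  forall K : R, exists nu0, forall nu, nu0 <= nu -> (K%:E <= mean_error nu)%E.
Proof.
move=> f2 conc K.
pose r := fine (\int[sigma d]_(x in sphere R d) (f x ^+ 2)%:E)%E.
have rE : (\int[sigma d]_(x in sphere R d) (f x ^+ 2)%:E = r%:E)%E.
  by rewrite fineK// ge0_fin_numE//; apply: integral_ge0 => x _; rewrite lee_fin sqr_ge0.
have r0 : 0 <= r.
  by rewrite -lee_fin -rE; apply: integral_ge0 => x _; rewrite lee_fin sqr_ge0.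
have nR : 0 < n%:R :> R by rewrite ltr0n.
(* Chosen so that, after division by 2 n^2 a^2, the bound K' a^2 <= b reads |K| + r + 1 <= c b,
   where r is the integral of f^2. *)
pose K' := 2 * n%:R ^+ 2 * (`|K| + r + 1).
have K'0 : 0 < K'.
  by rewrite !mulr_gt0// ?exprn_gt0// ltr_wpDl// addr_ge0.
have [nu0 nu0P] := conc _ K'0.
exists (Num.max nu0 0) => nu; rewrite ge_max => /andP[/nu0P].
have mpsi : measurable_fun setT (fun s => phi s ^+ 2) by exact: measurable_funX.
have psi0 s : 0 <= phi s ^+ 2 by exact: sqr_ge0.
have M0 : 0 <= M by rewrite (le_trans (phi0 0))//; case/andP: (phiM 0).
have psiM s : 0 <= phi s ^+ 2 <= M ^+ 2.
  by rewrite psi0 lerXn2r ?nnegrE//; case/andP: (phiM s).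
set b := fine _ => KA nuge0.
have A0 := mass_gt0 nuge0; set a := mass nu in KA A0.
pose c := (2 * n%:R ^+ 2 * a ^+ 2)^-1.
have c0 : 0 <= c by rewrite invr_ge0 mulr_ge0 ?sqr_ge0// mulr_ge0 ?sqr_ge0.
have inner w : (`|K|%:E <= \int[sigma d]_x sq_error nu (w, x))%E.
  pose y := X (Ordinal n0) w.
  pose p x := phi ((1 - dotp x y) * nu ^+ 2).
  have bE : (\int[sigma d]_(x in sphere R d) (p x ^+ 2)%:E = b%:E)%E.
    rewrite -[LHS]/(zonal (fun s => phi s ^+ 2) nu y).
    rewrite (zonal_const nu mpsi psi0 (SX _ _) sphere_pole) fineK//.
    exact: (zonal_fin_num _ _ mpsi psiM).
  rewrite (_ : (\int[sigma d]_x sq_error nu (w, x))%E =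
    (\int[sigma d]_(x in sphere R d) ((estimator nu w x - f x) ^+ 2)%:E)%E); last first.
    rewrite [RHS]integral_mkcond; apply: eq_integral => x _.
    rewrite /sq_error /= !patchE indicE; case: ifPn => _; first by rewrite mulr1.
    by rewrite mulr0.
  set I := (\int[sigma d]_(x in _) _)%E.
  have h : (c%:E * b%:E <= I + r%:E)%E.
    have mest : measurable_fun setT (estimator nu w).
      apply: measurable_funM; first exact: measurable_cst.
      apply: measurable_sum => i; apply: measurable_funM; first exact: measurable_cst.
      apply: (measurableT_comp mphi); apply: measurable_funM; last exact: measurable_cst.
      by apply: measurable_funB; [exact: measurable_cst|exact: measurable_dotpr].
    have me : measurable_fun (sphere R d) (fun x => ((estimator nu w x - f x) ^+ 2)%:E).
      apply/measurable_EFinP; apply: measurable_funX; apply: measurable_funB => //.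
      exact: measurable_funTS.
    have mf2 : measurable_fun (sphere R d) (fun x => (f x ^+ 2)%:E).
      by apply/measurable_EFinP; exact: measurable_funX.
    have mp2 : measurable_fun (sphere R d) (fun x => (p x ^+ 2)%:E).
      exact: (measurable_funTS (measurable_zonal_integrand nu y mpsi)).
    have p20 x : sphere R d x -> (0 <= (p x ^+ 2)%:E)%E by rewrite lee_fin sqr_ge0.
    pose e1 x : \bar R := ((estimator nu w x - f x) ^+ 2)%:E.
    pose e2 x : \bar R := (f x ^+ 2)%:E.
    have mS' := @measurable_sphere R d.
    have e10 x : (0 <= e1 x)%E by rewrite lee_fin sqr_ge0.
    have e20 x : (0 <= e2 x)%E by rewrite lee_fin sqr_ge0.
    rewrite /I -bE -rE -(ge0_integralZl_EFin _ _ _ _ c0)//.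
    rewrite -(@ge0_integralD _ _ _ (sigma d) _ mS' e1 e2)//.
    apply: ge0_le_integral => //.
    - by move=> x Sx; rewrite mule_ge0 ?p20.
    - exact: measurable_funeM.
    - by apply: emeasurable_funD.
    move=> x _; rewrite -EFinM -EFinD lee_fin.
    set k := estimator nu w x; set t := (n%:R * a)^-1 * p x.
    have t0 : 0 <= t by rewrite mulr_ge0 ?phi0// invr_ge0 mulr_ge0// ltW.
    have tk : t <= k.
      rewrite /k /estimator (bigD1 (Ordinal n0))//= mulrDr -/y -/(p x) /t invfM mulrA.
      rewrite lerDl mulr_ge0 ?invr_ge0//; apply: sumr_ge0 => i _.
      by rewrite mulr_ge0// invr_ge0 ltW.
    have -> : c * p x ^+ 2 = t ^+ 2 / 2.
      by rewrite /c /t; field; rewrite !gt_eqF.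
    have : t ^+ 2 <= k ^+ 2 by rewrite lerXn2r// nnegrE// (le_trans t0).
    (* (k - f)^2 + f^2 - k^2 / 2 = (k - 2 f)^2 / 2. *)
    have := sqr_ge0 (k - 2 * f x); nra.
  have hr : `|K| <= c * b - r.
    have : c * (K' * a ^+ 2) <= c * b by rewrite ler_wpM2l.
    rewrite (_ : c * _ = `|K| + r + 1); last first.
      by rewrite /c /K'; field; rewrite !gt_eqF.
    lra.
  apply: (@le_trans _ _ (c * b - r)%:E); first by rewrite lee_fin.
  by rewrite EFinB leeBlDr// EFinM.
apply: (@le_trans _ _ `|K|%:E); first by rewrite lee_fin ler_norm.
rewrite /mean_error; apply: (@le_trans _ _ (\int[P]_w (cst `|K|%:E w))%E).
  have PT : P [set: Omega] = 1%E by exact: probability_setT.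
  by rewrite integral_cst// (etrans (congr1 (mule `|K|%:E) PT) (mule1 _)).
apply: ge0_le_integral => //.
  by move=> w _; rewrite lee_fin.
apply: (@measurable_fun_fubini_tonelli_F _ _ _ _ _ (sigma d) (sq_error nu)).
  exact: measurable_sq_error.
exact: sq_error_ge0.
Qed.

End mean_integrated_error.

(** * Identification of [MISE2] with the mean error *)

Section mise.
Context {R : realType}.
Local Notation sigma := (surface_measure R).

Lemma sample_integrandE (d : nat) (L : R -> R) (x y : d.+1.-tuple R) (nu : R) :
  sphere R d x -> sphere R d y ->
  L ((1 - dotp x y) / nu^-1 ^+ 2) = L (Num.max ((1 - dotp x y) * nu ^+ 2) 0).
Proof.
move=> Sx Sy; rewrite exprVn invrK (max_idPl _)// mulr_ge0 ?sqr_ge0//.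
by rewrite subr_ge0 sphere_dotp_le1.
Qed.

(** The value prescribed at nu = 0 is that of the same formula: all kernel arguments vanish there,
    the mass is L(0) omega_d, and L(0) > 0 cancels, leaving the uniform density. For nu > 0 the
    normalizing constants at the sample points equal [mass] by [zonal_const]. *)
Lemma MISE2E (d n : nat) (f : d.+1.-tuple R -> R) (L : R -> R) (M : R)
    (dO : measure_display) (Omega : measurableType dO) (P : probability Omega R)
    (X : 'I_n -> {RV P >-> d.+1.-tuple R}) (nu : R) :
  (0 < n)%N -> continuous (fun s : R => L (Num.max s 0)) ->
  (forall s, 0 <= L (Num.max s 0) <= M) -> 0 < L 0 ->
  (forall i w, sphere R d (X i w)) -> 0 <= nu ->
  MISE2 L f X nu =
  mean_error f (fun s => L (Num.max s 0)) P (fun i => X i : Omega -> _) nu.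
Proof.
move=> n0 cphi phiM L0 SX nu0.
pose phi s := L (Num.max s 0).
have mphi : measurable_fun setT phi by exact: continuous_measurable_fun.
have phi0 s : 0 <= phi s by case/andP: (phiM s).
have nR : n%:R != 0 :> R by rewrite pnatr_eq0 -lt0n.
have innerE t w : (\int[sigma d]_x
    sq_error f phi (fun i => X i : Omega -> _) t (w, x) =
  \int[sigma d]_(x in sphere R d)
    ((estimator phi (fun i => X i : Omega -> _) t w x - f x) ^+ 2)%:E)%E.
  rewrite [RHS]integral_mkcond; apply: eq_integral => x _.
  rewrite /sq_error /= !patchE indicE; case: ifPn => _; first by rewrite mulr1.
  by rewrite mulr0.
rewrite /MISE2 /mean_error; case: eqVneq => [->|nuN0].
  have -> : (\int[sigma d]_(x in sphere R d) (((omega R d)^-1 - f x) ^+ 2)%:E =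
     \int[P]_w (cst (\int[sigma d]_(x in sphere R d) (((omega R d)^-1 - f x) ^+ 2)%:E) w))%E.
    have PT : P [set: Omega] = 1%E by exact: probability_setT.
    by rewrite integral_cst// (etrans (congr1 (mule _) PT) (mule1 _)).
  have massE : mass d phi 0 = L 0 * omega R d.
    rewrite /mass /zonal (_ : (\int[sigma d]_(x in sphere R d) _)%E =
      (\int[sigma d]_(x in sphere R d) (cst (L 0)%:E) x)%E); last first.
      by apply: eq_integral => x _; rewrite expr0n mulr0 /phi maxxx.
    have mS := @measurable_sphere R d.
    by rewrite integral_cst// fineM//; exact: fin_num_measure.
  apply: eq_integral => w _; rewrite innerE; apply: eq_integral => x _.
  congr (((_ - _) ^+ 2)%:E); rewrite /estimator massE.
  under eq_bigr do rewrite expr0n mulr0 /phi maxxx.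
  rewrite sumr_const card_ord -[X in _ = _ * X]mulr_natl mulKf// invfM mulrAC.
  by rewrite mulVf ?gt_eqF// mul1r.
apply: eq_integral => w _; rewrite innerE; apply: eq_integral => x /set_mem Sx.
congr (((_ - _) ^+ 2)%:E); rewrite /kde /estimator; congr (_ * _).
apply: eq_bigr => i _; rewrite /scaled_kernel sample_integrandE//; congr (_ * _).
rewrite /norm_const /mass; congr (fine _)^-1.
rewrite -(zonal_const nu mphi phi0 (SX i w) (sphere_pole R d)).
by apply: eq_integral => z /set_mem Sz; rewrite sample_integrandE.
Qed.

End mise.

Unset Implicit Arguments.
Set Strict Implicit.

Theorem theorem2p1 (R : realType) (d n : nat) (hd : (1 <= d)%N) (hn : (1 <= n)%N)
  (f : d.+1.-tuple R -> R)
  (f_density : is_density f) (f_L2 : square_integrable f)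
  (L : R -> R)
  (L_ge0 : forall s : R, 0 <= s -> 0 <= L s)
  (L_cont : {within `[0, +oo[, continuous L})
  (L_bounded : exists M : R, forall s : R, 0 <= s -> L s <= M)
  (L_int : (@lebesgue_measure R).-integrable `[0, +oo[ (EFin \o L))
  (L0_gt0 : 0 < L 0)
  (lambda_fin : forall k : nat, (1 <= k <= 2)%N ->
     (0 < lambda d (fun s => (L s ^+ k)%R) < +oo)%E)
  (beta_fin : (beta d 2 L < +oo)%E)
  (dO : measure_display) (Omega : measurableType dO) (P : probability Omega R)
  (X : 'I_n -> {RV P >-> d.+1.-tuple R}) (X_iid : iid_sample f X) :
  exists nu_MISE : R, 0 <= nu_MISE /\
    forall nu : R, 0 <= nu ->
      (MISE2 L f X nu_MISE <= MISE2 L f X nu)%E.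

Proof.
pose phi s := L (Num.max s 0).
have cphi : continuous phi by exact: continuous_max0.
have [M LM] := L_bounded.
have max0 s : 0 <= Num.max s 0 :> R by rewrite le_max lexx orbT.
have phiM s : 0 <= phi s <= M by rewrite L_ge0// LM.
have phi00 : 0 < phi 0 by rewrite /phi maxxx.
have [mf _ _] := f_density.
have [SX _ _] := X_iid.
have Spole := sphere_pole R d.
have mL := measurable_int _ L_int.
have [Q tail] := kernel_tail (proj1 (measurable_EFinP _ _) mL) L_ge0 L_int (lambda_fin 1%N isT).
have conc := concentration hd Spole cphi phiM phi00 tail.
have mX i : measurable_fun setT (X i : Omega -> _) by [].
have E0 t : 0 <= t -> (0 <= mean_error f phi P (fun i => X i : Omega -> _) t)%E.
  by move=> _; apply: integral_ge0 => w _; apply: integral_ge0 => x _; exact: sq_error_ge0.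
have [nu [nu0 numin]] := sequentially_lsc_coercive_min E0
  (mean_error_lsc P mf cphi phiM phi00 mX)
  (mean_error_coercive P hn mf cphi phiM phi00 mX SX f_L2 conc).
exists nu; split=> // t t0.
by rewrite !(@MISE2E R d n f L M)//; exact: numin.
Qed.
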